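(* Let $\mathcal{P}$ and $\mathcal{P}_n$, $n=1,2,\dots$, be pyramids. If $\mathcal{P}_n$ converges weakly to $\mathcal{P}$ as $n\to\infty$, then $$\operatorname{ObsDiam}(\mathcal{P};-\kappa)=\lim_{\varepsilon\to0+}\liminf_{n\to\infty}\operatorname{ObsDiam}(\mathcal{P}_n;-(\kappa+\varepsilon))=\lim_{\varepsilon\to0+}\limsup_{n\to\infty}\operatorname{ObsDiam}(\mathcal{P}_n;-(\kappa+\varepsilon))$$ and $$\operatorname{Sep}(\mathcal{P};\kappa_0,\dots,\kappa_N)=\lim_{\varepsilon\to0+}\liminf_{n\to\infty}\operatorname{Sep}(\mathcal{P}_n;\kappa_0-\varepsilon,\dots,\kappa_N-\varepsilon)=\lim_{\varepsilon\to0+}\limsup_{n\to\infty}\operatorname{Sep}(\mathcal{P}_n;\kappa_0-\varepsilon,\dots,\kappa_N-\varepsilon)$$ for any real numbers $\kappa,\kappa_0,\dots,\kappa_N>0$ (with $N\ge1$). All values are in $[0,+\infty]$.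
   Context: An mm-space is a triple $(X,d_X,\mu_X)$ with $(X,d_X)$ a complete separable metric space and $\mu_X$ a Borel probability measure; we always assume $X=\operatorname{supp}\mu_X$. Two mm-spaces are mm-isomorphic if there is an isometry between the supports of their measures pushing one measure to the other. $\mathcal{X}$ is the set of mm-isomorphism classes of mm-spaces. $Y\prec X$ means there is a $1$-Lipschitz map $f:X\to Y$ with $f_*\mu_X=\mu_Y$. Box distance: a parameter of $X$ is a Borel map $\varphi:I=[0,1)\to X$ with $\varphi_*\mathcal{L}^1=\mu_X$ ($\mathcal{L}^1$ Lebesgue measure). $\square(X,Y)$ is the infimum of $\varepsilon\ge0$ such that there are parameters $\varphi$ of $X$, $\psi$ of $Y$ and a Borel set $I_0\subset I$ with $\mathcal{L}^1(I_0)\ge1-\varepsilon$ and $|d_X(\varphi(s),\varphi(t))-d_Y(\psi(s),\psi(t))|\le\varepsilon$ for all $s,t\in I_0$. It is a metric on $\mathcal{X}$. A pyramid is a nonempty $\square$-closed subset $\mathcal{P}\subset\mathcal{X}$ such that (i) $X\in\mathcal{P}$ and $Y\prec X$ imply $Y\in\mathcal{P}$; (ii) for any $X,X'\in\mathcal{P}$ there is $Y\in\mathcal{P}$ with $X\prec Y$, $X'\prec Y$. Weak convergence $\mathcal{P}_n\to\mathcal{P}$ of pyramids: $\lim_{n}\square(X,\mathcal{P}_n)=0$ for every $X\in\mathcal{P}$, and $\liminf_n\square(X,\mathcal{P}_n)>0$ for every $X\in\mathcal{X}\setminus\mathcal{P}$, where $\square(X,\mathcal{P}_n)=\inf_{Y\in\mathcal{P}_n}\square(X,Y)$.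 Observable diameter: for a Borel probability measure $\nu$ on a metric space and $\alpha\in\mathbb{R}$, $\operatorname{diam}(\nu;\alpha)$ is the infimum of $\operatorname{diam}(A)$ over Borel sets $A$ with $\nu(A)\ge\alpha$ (so it is $0$ if $\alpha\le0$). For an mm-space $X$ and $\kappa>0$, $\operatorname{ObsDiam}(X;-\kappa)=\sup\{\operatorname{diam}(f_*\mu_X;1-\kappa)\mid f:X\to\mathbb{R}\text{ is }1\text{-Lipschitz}\}$. For a pyramid, $\operatorname{ObsDiam}(\mathcal{P};-\kappa)=\lim_{\delta\to0+}\sup_{X\in\mathcal{P}}\operatorname{ObsDiam}(X;-(\kappa+\delta))$. Separation distance: for an mm-space $X$ and $\kappa_0,\dots,\kappa_N>0$, $N\ge1$, $\operatorname{Sep}(X;\kappa_0,\dots,\kappa_N)$ is the supremum of $\min_{i\ne j}d_X(A_i,A_j)$ over Borel sets $A_0,\dots,A_N\subset X$ with $\mu_X(A_i)\ge\kappa_i$ for all $i$, where $d_X(A,B)=\inf_{x\in A,y\in B}d_X(x,y)$; it is $0$ if no such sets exist. For a pyramid, $\operatorname{Sep}(\mathcal{P};\kappa_0,\dots,\kappa_N)=\lim_{\delta\to0+}\sup_{X\in\mathcal{P}}\operatorname{Sep}(X;\kappa_0-\delta,\dots,\kappa_N-\delta)$. *)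

(* Defs.v *)
(* Metric measure geometry on top of MathComp-Analysis. *)
From HB Require Import structures.
From mathcomp Require Import all_boot all_order all_algebra.
From mathcomp Require Import all_classical all_reals all_analysis.

Set Implicit Arguments.
Unset Strict Implicit.
Unset Printing Implicit Defensive.

Import Order.TTheory GRing.Theory Num.Theory.
Import numFieldNormedType.Exports.

Local Open Scope classical_set_scope.
Local Open Scope ring_scope.

Notation borel T := (g_sigma_algebraType (@open T)).

(* The library's complete spaces and measurable spaces are pointed. This loses
   no generality: a space carrying a probability measure is nonempty, and the
   chosen point is never used. *)
#[short(type="completeMetricType")]
HB.structure Definition CompleteMetric (R : realType) :=
  {T of Metric R T & Complete T}.

(* The real line must be an admissible carrier. By universe constraints, this
   excludes [set (mmSpace R)], so families of spaces are written as plain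
   predicates mmSpace R -> Prop below. *)
HB.instance Definition _ (R : realType) := Complete.copy R^o R^o.

Definition separable (T : topologicalType) :=
  exists2 D : set T, countable D & dense D.

Definition msupp (R : realType) (T : ptopologicalType)
    (mu : set (borel T) -> \bar R) : set T :=
  [set x | forall U : set T, open U -> U x -> (0 < mu U)%E].

Record mmSpace (R : realType) := MMSpace {
  mm_sort :> completeMetricType R ;
  mm_separable : separable mm_sort ;
  mm_mu : probability (borel mm_sort) R ;
  mm_supp : msupp mm_mu = [set: mm_sort] }.

Section mm_spaces.
Context {R : realType}.
Implicit Types (X Y : mmSpace R) (P : mmSpace R -> Prop).

Definition lip1 (T U : metricType R) (f : T -> U) :=
  forall x y, mdist (f x) (f y) <= mdist x y.

Definition pushes X Y (f : X -> Y) :=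
  forall A : set (borel Y), measurable A -> mm_mu X (f @^-1` A) = mm_mu Y A.

Definition mm_iso X Y :=
  exists f : X -> Y, [/\ forall x y, mdist (f x) (f y) = mdist x y,
    set_surj [set: X] [set: Y] f & pushes f].

(* [dominated Y X] is Y ≺ X; Borel measurability of f is automatic. *)
Definition dominated Y X := exists2 f : X -> Y, lip1 f & pushes f.

(* phi is only relevant on I = [0, 1). *)
Definition parameter X (phi : R -> X) :=
  measurable_fun (`[0, 1[%classic : set (measurableTypeR R))
    (phi : measurableTypeR R -> borel X) /\
  forall A : set (borel X), measurable A ->
    lebesgue_measure (`[0, 1[%classic `&` phi @^-1` A) = mm_mu X A.

Definition box X Y : \bar R :=
  ereal_inf [set e%:E | e in [set e : R | 0 <= e /\
    exists (phi : R -> X) (psi : R -> Y) (I0 : set (measurableTypeR R)),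
    [/\ parameter phi, parameter psi, measurable I0, I0 `<=` `[0, 1[%classic &
        ((1 - e)%:E <= lebesgue_measure I0)%E /\
        forall s t, I0 s -> I0 t ->
          `| mdist (phi s) (phi t) - mdist (psi s) (psi t) | <= e]]].

Definition box_set X P : \bar R := ereal_inf [set r | exists2 Y, P Y & box X Y = r].

(* A set of isomorphism classes is an isomorphism-invariant set of spaces. *)
Record pyramid P : Prop := {
  pyramid_iso : forall X Y, mm_iso X Y -> P X -> P Y ;
  pyramid_nonempty : exists X, P X ;
  pyramid_closed : forall X,
    (forall e : R, 0 < e -> exists2 Y, P Y & (box X Y < e%:E)%E) -> P X ;
  pyramid_down : forall X Y, P X -> dominated Y X -> P Y ;
  pyramid_directed : forall X X', P X -> P X' ->
    exists Y, [/\ P Y, dominated X Y & dominated X' Y] }.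

Definition weak_cvg (P_ : nat -> mmSpace R -> Prop) P :=
  (forall X, P X -> box_set X (P_ n) @[n --> \oo] --> 0%E) /\
  (forall X, ~ P X -> (0 < limn_einf (fun n => box_set X (P_ n)))%E).

(* The maximum with 0 only serves to give the empty set diameter 0. *)
Definition diam (T : metricType R) (A : set T) : \bar R :=
  maxe 0%E (ereal_sup [set (mdist x y)%:E | x in A & y in A]).

Definition partial_diam (T : metricType R) (nu : set T -> \bar R) (alpha : R)
    : \bar R :=
  ereal_inf [set diam A | A in [set A | <<s @open T >> A /\
                                        (alpha%:E <= nu A)%E]].

(* ObsDiam(X; - kappa) *)
Definition obs_diam X (kappa : R) : \bar R :=
  ereal_sup [set partial_diam
                   (pushforward (mm_mu X) (f : borel X -> borel R^o))
                   (1 - kappa)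
            | f in [set f : X -> R^o | lip1 f]].

(* The supremum is nonincreasing in delta, so the limit exists. *)
Definition pyr_obs_diam P (kappa : R) : \bar R :=
  lim (ereal_sup [set r | exists2 X, P X & obs_diam X (kappa + delta) = r]
       @[delta --> 0^'+]).

Definition set_dist (T : metricType R) (A B : set T) : \bar R :=
  ereal_inf [set (mdist x y)%:E | x in A & y in B].

(* The maximum with 0 only serves to give 0 when no such sets exist. *)
Definition sep X N (kappa : 'I_N.+1 -> R) : \bar R :=
  maxe 0%E (ereal_sup
    [set \big[mine/+oo%E]_(ij : 'I_N.+1 * 'I_N.+1 | ij.1 != ij.2)
           set_dist (A ij.1) (A ij.2)
    | A in [set A : 'I_N.+1 -> set (borel X) |
             forall i, measurable (A i) /\
                       ((kappa i)%:E <= mm_mu X (A i))%E]]).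

(* Only small delta matter, for which every kappa i - delta is positive. *)
Definition pyr_sep P N (kappa : 'I_N.+1 -> R) : \bar R :=
  lim (ereal_sup [set r | exists2 X, P X &
                     sep X (fun i => kappa i - delta) = r]
       @[delta --> 0^'+]).

End mm_spaces.

(* Main.v *)
(** Both invariants are stable under the box distance: a small box distance moves
    ObsDiam and Sep little, at the price of a small change of the masses.
    Approximating one X in P by elements of the P_n gives the lower bounds.

    For the upper bounds one needs compactness. A value ObsDiam or Sep > a in P_n
    is already witnessed by a 1-Lipschitz image of bounded one-dimensional type:
    the line after contracting the stretches of small mass (ObsDiam), or a star
    with legs of length a / 2 around which the separated sets sit (Sep). The law
    of such an image has a parameter theta o q with theta fixed and Lipschitz and
    q : [0, 1) -> [0, D] the nondecreasing quantile function. Nondecreasing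
    functions into [0, D] have cluster points for pointwise convergence, and these
    are close to the sequence outside a small set. Hence some space Z has box
    distance 0 to the P_n along a subsequence, which forces Z in P, and stability
    carries the lower bound over to Z. *)
From HB Require Import structures.
Require Import Defs.
From mathcomp Require Import all_boot all_order all_algebra.
From mathcomp Require Import all_classical all_reals all_analysis.
From mathcomp Require Import measurable_realfun.
From mathcomp Require Import lra.

Set Implicit Arguments.
Unset Strict Implicit.
Unset Printing Implicit Defensive.

Import Order.TTheory GRing.Theory Num.Theory.
Import numFieldNormedType.Exports.

Local Open Scope classical_set_scope.
Local Open Scope ring_scope.

(** * Closed subspaces and supports *)

(** A pyramid need not be compact, and weak convergence is tested only against single spaces, so an
    upper bound needs one concrete space that retains the large invariant. The second clause of weak
    convergence then applies: for a space outside P the lower limit of the box distances to P_n is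
    positive, which closeness for infinitely many n excludes. The large value has to be retained by
    every space realizing the same law, because the image of X is rebuilt from a quantile function
    and is not the image set itself. With theta common to all spaces, they are compared at the same
    t, and the box distance is controlled by |q - Q| alone. As epsilon decreases, the lower and
    upper limits in n increase for ObsDiam and decrease for Sep. Hence for ObsDiam the upper bound
    holds at every epsilon > 0 and the lower bound needs epsilon small. For Sep the roles are
    exchanged, and epsilon must also leave the masses positive, so that the separated sets are
    nonempty. *)

Section metric_facts.
Context {R : realType}.

Lemma nbhs_mdist (T : metricType R) (x : T) (A : set T) :
  nbhs x A <-> exists2 e : R, 0 < e & forall y, mdist x y < e -> A y.
Proof.
rewrite -metricType_numDomainType.filter_from_mdist_nbhs.
split; by case=> e e0 eA; exists e.
Qed.

Lemma lip1_continuous (T U : metricType R) (f : T -> U) : lip1 f -> continuous f.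
Proof.
move=> lf x A /nbhs_mdist[e e0 eA]; apply/nbhs_mdist; exists e => // y xy.
by apply: eA; rewrite (le_lt_trans (lf _ _)).
Qed.

Lemma continuous_borel (T U : ptopologicalType) (f : T -> U) : continuous f ->
  measurable_fun setT (f : borel T -> borel U).
Proof.
move=> /continuousP cf.
apply: (@measurability _ _ (borel T) (borel U) setT f (@open U)) => //.
move=> _ [B oB <-]; rewrite setTI; apply: sub_sigma_algebra; exact: cf.
Qed.

End metric_facts.

Section closed_subspace.
Context {R : realType} (T : completeMetricType R) (S : set T).
Hypothesis cS : closed S.
Variable x0 : S.

Let d (x y : S) : R := mdist (set_val x) (set_val y).
Let d_ge0 x y : 0 <= d x y. Proof. exact: mdist_ge0. Qed.
Let d_pos x y : d x y = 0 -> x = y.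
Proof. move=> /mdist_positivity; exact: val_inj. Qed.
Let d_ball x e : ball x e = [set y | d x y < e].
Proof. by rewrite -initial_ballE ballEmdist. Qed.

Let U : puniformType :=
  HB.pack (set_type S) (isPointed.Build (set_type S) x0).

Let d_cauchy (F : set_system U) : ProperFilter F -> cauchy F -> cvg F.
Proof.
move=> PF /cauchyP cF.
have cG : cauchy (set_val @ F : set_system T).
  apply/cauchyP => e e0; have [x Fx] := cF _ e0.
  exists (set_val x); rewrite /nbhs/=; apply: filterS Fx => y.
  by rewrite -initial_ballE.
have := cauchy_cvg _ cG; set l := lim (set_val @ F) => Fl.
have Sl : S l.
  apply: cS => B /Fl FB.
  have /filter_ex[y By] : F (set_val @^-1` B) by exact: FB.
  by exists (set_val y); split => //; exact: set_valP.
apply: (@cvgP U _ (exist _ l (mem_set Sl) : S)) => B.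
rewrite -nbhs_ballE => -[e/= e0 eB].
have Fb : F (set_val @^-1` (ball l e)) by apply: Fl; exact: nbhsx_ballx.
by rewrite nbhs_filterE; apply: filterS eB _; rewrite -initial_ballE.
Qed.

Definition closed_subspace : completeMetricType R :=
  HB.pack (set_type S)
    (@PseudoMetric_isMetric.Build R (set_type S) d d_ge0 d_pos d_ball)
    (isPointed.Build (set_type S) x0)
    (Uniform_isComplete.Build U d_cauchy).

Lemma closed_subspace_mdist (x y : closed_subspace) :
  mdist x y = mdist (set_val (x : S)) (set_val (y : S)).
Proof. by []. Qed.
End closed_subspace.

Section separability.
Context {R : realType}.

Lemma mdist_ball_open (T : metricType R) (x : T) (e : R) :
  open [set y | mdist x y < e].
Proof.
rewrite openE => y/= xy; apply/nbhs_mdist; exists (e - mdist x y).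
  by rewrite subr_gt0.
by move=> z yz; rewrite /= (le_lt_trans (metric_triangle _ y _))// -ltrBrDl.
Qed.

Lemma separable_seq (T : completeMetricType R) : separable T ->
  exists g : nat -> T, forall x (e : R), 0 < e -> exists n, mdist (g n) x < e.
Proof.
move=> [D /pcard_surjP[g gD] dD]; exists g => x e e0.
have [||y/= [xy Dy]] := dD [set y | mdist x y < e].
- by exists x; rewrite /= mdistxx.
- exact: mdist_ball_open.
by have [n _ gn] := gD _ Dy; exists n; rewrite gn metric_sym.
Qed.

Lemma seq_separable (T : completeMetricType R) (g : nat -> T) :
  (forall x (e : R), 0 < e -> exists n, mdist (g n) x < e) -> separable T.
Proof.
move=> gd; exists (range g).
  by apply: (sub_countable (card_image_le _ _)); exact: countableP.
move=> O [x Ox]; rewrite openE => /(_ _ Ox)/nbhs_mdist[e e0 eO].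
have [n gn] := gd x _ e0; exists (g n); split; last by exists n.
by apply: eO; rewrite metric_sym.
Qed.

Lemma exists_invn (e : R) : 0 < e -> exists k, k.+1%:R^-1 < e.
Proof.
move=> e0; exists (Num.truncn e^-1).
by rewrite invf_plt ?posrE// truncnS_gt.
Qed.

(** The dense sequence of T may miss S. Each pair (n, k) contributes a point of S at distance below
    1 / (k + 1) from [g n], if there is one; when [g n] is that close to x in S, the chosen point is
    within 2 / (k + 1) of x. *)
Lemma closed_subspace_separable (T : completeMetricType R) (S : set T)
  (cS : closed S) (x0 : S) : separable T -> separable (closed_subspace cS x0).
Proof.
move=> /separable_seq[g gd].
pose P n k (x : S) := mdist (g n) (set_val x) < k.+1%:R^-1.
pose h (m : nat) : closed_subspace cS x0 :=
  if @unpickle (nat * nat)%type m is Some (n, k) then xget x0 [set x | P n k x] else x0.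
apply: (seq_separable (g := h)) => x e e0.
have [k ke] : exists k, k.+1%:R^-1 < e / 2 by apply: exists_invn; rewrite divr_gt0.
have [n nx] := gd (set_val (x : S)) k.+1%:R^-1 ltac:(by rewrite invr_gt0).
exists (pickle (n, k)); rewrite /h pickleK closed_subspace_mdist.
case: xgetP => [y _ Py|/(_ x)]; last by [].
rewrite (le_lt_trans (metric_triangle _ (g n) _))// (splitr e).
by rewrite ltrD// (lt_trans _ ke)// metric_sym.
Qed.

End separability.

Section uniform_law.
Context {R : realType}.

(** Extended by zero to the whole line, the uniform law is a probability on [measurableTypeR R], and
    a measurable map on the line becomes a random variable. *)
Definition unif : set (measurableTypeR R) -> \bar R :=
  mrestr lebesgue_measure (measurable_itv `[0, 1[).

HB.instance Definition _ := Measure.on unif.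

Lemma unifE A : unif A = lebesgue_measure (`[0, 1[%classic `&` A).
Proof. by rewrite /unif /mrestr setIC. Qed.

Let unif_setT : unif [set: _] = 1%:E.
Proof. by rewrite unifE setIT lebesgue_measure_itv/= lte01 sube0. Qed.

HB.instance Definition _ := Measure_isProbability.Build _ _ _ unif unif_setT.

End uniform_law.

Section support.
Context {R : realType} (T : completeMetricType R).
Hypothesis sepT : separable T.
Variable nu : probability (borel T) R.

Lemma borel_open (U : set T) : open U -> measurable (U : set (borel T)).
Proof. exact: sub_sigma_algebra. Qed.

Lemma borel_closed (U : set T) : closed U -> measurable (U : set (borel T)).
Proof.
move=> cU; rewrite -(setCK U); apply: measurableC.
by apply: borel_open; exact: (closed_openC cU).
Qed.

Lemma msupp_closed : closed (msupp nu).
Proof.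
move=> x cx U oU Ux.
have [y [sy Uy]] := cx U (open_nbhs_nbhs (conj oU Ux)).
exact: sy.
Qed.

(** By separability, every point with a null open neighbourhood lies in one of countably many null
    balls with centre [g n] and radius 1 / (k + 1). *)
Lemma msuppC_null : nu (~` msupp nu) = 0%E.
Proof.
have [g gd] := separable_seq sepT.
pose B n k := [set y | mdist (g n) y < k.+1%:R^-1].
pose F (m : nat) : set (borel T) :=
  if @unpickle (nat * nat)%type m is Some (n, k) then
    if nu (B n k) == 0%E then B n k else set0 else set0.
have nF m : nu.-negligible (F m).
  rewrite /F; case: unpickle => [[n k]|]; last exact: negligible_set0.
  case: eqP => [B0|_]; last exact: negligible_set0.
  by exists (B n k); split => //; apply: borel_open; exact: mdist_ball_open.
apply: measure_negligible.
  by apply: measurableC; apply: borel_closed; exact: msupp_closed.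
apply: negligibleS (negligible_bigcup nF) => x /existsNP[U /not_implyP[oU]].
move=> /not_implyP[Ux /negP]; rewrite -leNgt => U0.
have /nbhs_mdist[e e0 eU] : nbhs x U by apply: open_nbhs_nbhs.
have [k ke] : exists k, k.+1%:R^-1 < e / 2 by apply: exists_invn; rewrite divr_gt0.
have [n nx] := gd x k.+1%:R^-1 ltac:(by rewrite invr_gt0).
exists (pickle (n, k)) => //; rewrite /F pickleK.
suff -> : nu (B n k) = 0%E by rewrite eqxx.
apply/eqP; rewrite eq_le measure_ge0 andbT (le_trans _ U0)//.
apply: le_measure; rewrite ?inE.
- by apply: borel_open; exact: mdist_ball_open.
- exact: borel_open.
move=> y/= By; apply: eU; rewrite (le_lt_trans (metric_triangle _ (g n) _))// (splitr e).
by rewrite ltrD// ?(lt_trans _ ke)// metric_sym.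
Qed.

Lemma msupp_nonempty : msupp nu !=set0.
Proof.
apply/set0P/eqP => s0; have := msuppC_null.
by rewrite s0 setC0 probability_setT => -[] /eqP; rewrite oner_eq0.
Qed.

Lemma measure_msuppI (A : set (borel T)) : measurable A ->
  nu (A `&` msupp nu) = nu A.
Proof.
move=> mA; have mS := borel_closed msupp_closed.
rewrite [RHS](measureDI nu mA mS) -[LHS]add0e; congr (_ + _)%E.
apply/esym/eqP; rewrite eq_le measure_ge0 andbT -msuppC_null.
by apply: le_measure; rewrite ?inE; [exact: measurableD|exact: measurableC|move=> x []].
Qed.
End support.
Section law.
Context {R : realType} (T : ptopologicalType).
Variable phi : measurableTypeR R -> borel T.
Hypothesis mphi : measurable_fun setT phi.

Definition law : probability (borel T) R :=
  distribution (unif : probability (measurableTypeR R) R)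
   (HB.pack_for {mfun (measurableTypeR R) >-> (borel T)} phi
     (isMeasurableFun.Build _ _ _ _ phi mphi)).

Lemma lawE A : law A = lebesgue_measure (`[0, 1[%classic `&` phi @^-1` A).
Proof. by rewrite -unifE. Qed.
End law.

Section support_space.
Context {R : realType} (T : completeMetricType R).
Hypothesis sepT : separable T.
Variable phi : measurableTypeR R -> borel T.
Hypothesis mphi : measurable_fun setT phi.

Let nu := law mphi.
Let S := msupp nu.
Let cS : closed S := @msupp_closed _ _ nu.
Let x0 : S := let: exist x Sx := cid (msupp_nonempty sepT nu) in exist _ x (mem_set Sx).
Let Z0 := closed_subspace cS x0.
Let iota : Z0 -> T := @set_val _ S.
(* The identity on the support; the null set outside it is sent to x0. *)
Let retr : T -> Z0 := insubd x0.

Let iota_in z : S (iota z). Proof. exact: set_valP. Qed.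

Let retrE x : iota (retr x) = if x \in S then x else iota x0.
Proof. by rewrite /iota /retr set_valE val_insubd. Qed.

Let retrK x : S x -> iota (retr x) = x.
Proof. by move=> Sx; rewrite retrE ifT//; exact: mem_set. Qed.

Let trace (A : set (borel Z0)) : measurable A ->
  exists2 B : set (borel T), measurable B & A = iota @^-1` B.
Proof.
(* Borel sets of the subspace are traces of Borel sets of T: generating a sigma-algebra commutes
   with taking preimages. *)
move=> mA; have : (preimage_set_system setT iota (@open T).-sigma.-measurable) A.
  rewrite -g_sigma_preimageE; move: A mA; apply: smallest_sub.
    exact: smallest_sigma_algebra.
  move=> _ [V oV <-]; apply: sub_sigma_algebra; exists V => //.
  by rewrite setTI.
by case=> B mB <-; exists B => //; rewrite setTI.
Qed.

Let mretr : measurable_fun setT (retr : borel T -> borel Z0).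
Proof.
move=> _ _ /trace[B mB ->]; rewrite setTI.
have mS := borel_closed cS.
suff -> : retr @^-1` (iota @^-1` B) =
    (B `&` S) `|` (if `[< B (iota x0) >] then ~` S else set0).
  by apply: measurableU; [exact: measurableI|case: ifP => // _; exact: measurableC].
apply/seteqP; split => x /=; rewrite retrE; case: (boolP (x \in S)).
- by move=> /set_mem Sx Bx; left.
- by move=> /negP nS Bx; right; case: asboolP => //= _ /mem_set.
- by move=> /set_mem Sx [[]//|]; case: ifP => // _ /(_ Sx).
- by move=> /negP nS [[_ /mem_set]//|]; case: asboolP.
Qed.

Let psi : measurableTypeR R -> borel Z0 := retr \o phi.
Let mpsi : measurable_fun setT psi.
Proof. exact: measurableT_comp. Qed.

Let mu_iota (B : set (borel T)) : measurable B -> law mpsi (iota @^-1` B) = nu B.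
Proof.
move=> mB; rewrite -(measure_msuppI sepT nu mB).
rewrite -[LHS]/(nu (retr @^-1` (iota @^-1` B))).
have mr : measurable (retr @^-1` (iota @^-1` B) : set (borel T)).
  rewrite -[X in measurable X]setTI; apply: mretr => //.
  rewrite -[X in measurable X]setTI.
  by apply: (continuous_borel (f := iota)) => //; exact: initial_continuous.
rewrite -(measure_msuppI sepT nu mr); congr (nu _).
by apply/seteqP; split => x /= [Bx Sx]; split => //; move: Bx; rewrite retrK.
Qed.

Let mm_full : msupp (law mpsi) = [set: Z0].
Proof.
apply/seteqP; split => // z _ U oU Uz; have [V oV VU] := oU.
rewrite -VU in Uz; rewrite -VU mu_iota; last exact: borel_open.
exact: (@iota_in z V oV Uz).
Qed.

(** An [mmSpace] must have full support, so a law on T becomes a space carried by its own support.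
    The almost sure equality transfers distance estimates from T to Z, the last conjunct transfers
    masses. *)
Lemma support_space : exists (Z : mmSpace R) (iota : Z -> T) (psi : R -> Z),
  [/\ forall x y, mdist (iota x) (iota y) = mdist x y,
      range iota = msupp (law mphi),
      parameter psi,
      {ae unif, forall t, iota (psi t) = phi t} &
      forall A : set (borel Z), measurable A -> exists B : set (borel T),
        [/\ measurable B, A = iota @^-1` B & mm_mu Z A = law mphi B]].
Proof.
exists (MMSpace (closed_subspace_separable cS x0 sepT) mm_full), iota, psi; split.
- by [].
- apply/seteqP; split => [_ [z _ <-]|x Sx]; first exact: iota_in.
  by exists (exist _ x (mem_set Sx) : S).
- split=> [|A mA]; first exact: measurable_funTS.
  by rewrite /= -lawE.
- exists (phi @^-1` ~` S); split.
  + rewrite -[X in measurable X]setTI; apply: mphi => //.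
    by apply: measurableC; exact: borel_closed.
  + exact: (msuppC_null sepT nu).
  + by move=> t /= + St; apply; exact: retrK.
- move=> A /trace[B mB ->]; exists B; split => //.
  exact: mu_iota.
Qed.
End support_space.

(** * Precompactness of laws on a bounded segment *)

Section monotone_cluster.
Context {R : realType}.
Implicit Types (D : R) (q : nat -> R -> R).

(** Tychonoff's theorem replaces the diagonal argument of Helly's theorem. A cluster point in the
    product over all of R gives no convergent subsequence, only closeness at finitely many points
    for infinitely many n; two points suffice to make Q monotone. *)
Lemma monotone_cluster_finite D q :
  (forall n, {homo q n : x y / x <= y}) -> (forall n t, 0 <= q n t <= D) ->
  exists Q : R -> R, [/\ {homo Q : x y / x <= y}, forall t, 0 <= Q t <= D &
    forall (e : R) (I : finType) (p : I -> R) N, 0 < e ->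
      exists2 n, (N <= n)%N & forall i, `|q n (p i) - Q (p i)| < e].
Proof.
move=> q_nd q_D.
have cK := @tychonoff R (fun=> R) (fun=> `[0, D]%classic)
  (fun=> @segment_compact R 0 D).
have [|Q [Q_D Qcl]] := cK (q @ \oo) _.
  by exists 0%N => // n _ t /=; rewrite in_itv/=; exact: q_D.
have close (e : R) (I : finType) (p : I -> R) N : 0 < e ->
    exists2 n, (N <= n)%N & forall i, `|q n (p i) - Q (p i)| < e.
  move=> e0.
  have nQ : nbhs (Q : prod_topology (fun=> R)) [set f | forall i, `|f (p i) - Q (p i)| < e].
    apply: (@filter_forall (R -> R) I (fun i => [set f | `|f (p i) - Q (p i)| < e]) _
      (@nbhs_filter (prod_topology (fun=> R)) Q)) => i.
    have := @proj_continuous R (fun=> R) (p i) Q _ (nbhsx_ballx (Q (p i)) e e0).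
    rewrite /nbhs/=; apply: (@filterS _ _ (@nbhs_filter (prod_topology (fun=> R)) Q)) => f.
    by rewrite /= -ball_normE/= distrC.
  have qN : (q @ \oo) [set f | exists2 n, (N <= n)%N & f = q n].
    by exists N => // n /= Nn; exists n.
  by have [f [[n Nn ->] fQ]] := Qcl _ _ qN nQ; exists n.
exists Q; split => // s t st.
apply/ler_addgt0Pl => e e0.
have [n _ qQ] := close (e / 2) bool (fun b => if b then s else t) 0%N ltac:(by rewrite divr_gt0).
have := q_nd n _ _ st; have := qQ true; have := qQ false => /=.
rewrite !ltr_norml; lra.
Qed.

Lemma monotone_diff_measurable (q Q : R -> R) (e : R) :
  {homo q : x y / x <= y} -> {homo Q : x y / x <= y} ->
  measurable ([set t | `|q t - Q t| <= e] : set (measurableTypeR R)).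
Proof.
move=> q_nd Q_nd.
rewrite (_ : mkset _ = (fun t => `|q t - Q t|) @^-1` `]-oo, e]); last first.
  by apply/seteqP; split => t; rewrite /= in_itv.
rewrite -[X in measurable X]setTI.
have mf : measurable_fun setT (fun t : measurableTypeR R => `|q t - Q t|).
  apply: (measurableT_comp (@normr_measurable R setT)).
  by apply: measurable_funB; exact: nondecreasing_measurable.
by apply: mf => //; exact: measurable_itv.
Qed.

(** Call a grid cell bad if Q rises by more than e on it. In a good cell, closeness at both ends and
    monotonicity give |q - Q| <= 2 e. The total rise of Q is at most D, so there are at most D / e
    bad cells, of total length at most D / (e (k + 1)) <= e. Formally, each bad cell is charged to
    the rise of Q on it, and the rises telescope. *)
Lemma monotone_grid_close D (q Q : R -> R) (e : R) (k : nat) :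
  {homo q : x y / x <= y} -> {homo Q : x y / x <= y} ->
  (forall t, 0 <= Q t <= D) -> 0 < e -> D <= e * (e * k.+1%:R) ->
  (forall j : 'I_k.+2, `|q (j%:R / k.+1%:R) - Q (j%:R / k.+1%:R)| < e) ->
  ((1 - e)%:E <= unif [set t | (`|q t - Q t| <= 2 * e)%R])%E.
Proof.
move=> q_nd Q_nd Q_D e0 De qQ; set G := [set t | _].
have mG : measurable (G : set (measurableTypeR R)) by exact: monotone_diff_measurable.
suff GC : (unif (~` G) <= e%:E)%E.
  rewrite -(setCK G) probability_setC; last exact: measurableC.
  by rewrite EFinB; apply: leeB.
pose g (j : nat) : R := j%:R / k.+1%:R.
pose F (j : nat) : set (measurableTypeR R) :=
  if e < Q (g j.+1) - Q (g j) then `[g j, g j.+1[%classic else set0.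
rewrite unifE.
have k0 : 0 < k.+1%:R :> R by rewrite ltr0Sn.
have gS j : g j.+1 = g j + k.+1%:R^-1 by rewrite /g -natr1 mulrDl mul1r.
have QF j : (lebesgue_measure (F j) <= ((Q (g j.+1) - Q (g j)) / (e * k.+1%:R))%:E)%E.
  have gle : g j <= g j.+1 by rewrite gS lerDl invr_ge0 ltW.
  have := Q_nd _ _ gle; rewrite /F; case: ifP => [Qe _|_ Qle].
    rewrite lebesgue_measure_itv/= lte_fin gS ltrDl invr_gt0 k0.
    rewrite -EFinB lee_fin addrAC subrr add0r -gS invfM mulrA.
    by rewrite ler_peMl ?invr_ge0 ?(ltW k0)// ler_pdivlMr// mul1r ltW.
  by rewrite measure0 lee_fin divr_ge0 ?subr_ge0// mulr_ge0// ltW.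
apply: (@le_trans _ _ (\sum_(j < k.+1) lebesgue_measure (F j))%E).
  apply: content_subadditive.
  - by move=> j _; rewrite /F; case: ifP => // _; exact: measurable_itv.
  - by apply: measurableI; [exact: measurable_itv|exact: measurableC].
  move=> t [/=]; rewrite in_itv/= => /andP[t0 t1] /negP; rewrite -ltNge => Gt.
  have tk : 0 <= t * k.+1%:R by rewrite mulr_ge0// ltW.
  pose j := Num.truncn (t * k.+1%:R).
  have /andP[jt tj] := truncn_itv tk; rewrite -/j in jt tj.
  have jk : (j < k.+1)%N by rewrite -(ltr_nat R) (le_lt_trans jt)// gtr_pMl.
  have gt : g j <= t by rewrite /g ler_pdivrMr.
  have tg : t < g j.+1 by rewrite /g ltr_pdivlMr.
  rewrite -bigcup_mkord; exists j => //; rewrite /F.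
  suff -> : e < Q (g j.+1) - Q (g j) by rewrite /= in_itv/= gt tg.
  rewrite ltNge; apply/negP => QQ.
  have := qQ (Ordinal (ltnW jk : (j < k.+2)%N)); have := qQ (Ordinal (jk : (j.+1 < k.+2)%N)).
  rewrite -/(g j) -/(g j.+1)/=.
  have := q_nd _ _ gt; have := q_nd _ _ (ltW tg).
  have := Q_nd _ _ gt; have := Q_nd _ _ (ltW tg).
  move: Gt; rewrite ltNge => /negP; rewrite ler_norml !ltr_norml; lra.
apply: (@le_trans _ _ (\sum_(j < k.+1) ((Q (g j.+1) - Q (g j)) / (e * k.+1%:R))%:E)%E).
  by apply: lee_sum => j _; exact: QF.
rewrite sumEFin lee_fin -mulr_suml ler_pdivrMr ?mulr_gt0//.
rewrite (le_trans _ De)// -(big_mkord xpredT (fun j => Q (g j.+1) - Q (g j))).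
rewrite (telescope_sumr (fun j => Q (g j)))//.
by have := Q_D (g k.+1); have := Q_D (g 0%N); lra.
Qed.

Lemma monotone_cluster D q :
  (forall n, {homo q n : x y / x <= y}) -> (forall n t, 0 <= q n t <= D) ->
  exists Q : R -> R, [/\ {homo Q : x y / x <= y}, forall t, 0 <= Q t <= D &
    forall (e : R) N, 0 < e -> exists2 n, (N <= n)%N &
      ((1 - e)%:E <= unif [set t | (`|q n t - Q t| <= 2 * e)%R])%E].
Proof.
move=> q_nd q_D; have [Q [Q_nd Q_D Qq]] := monotone_cluster_finite q_nd q_D.
exists Q; split => // e N e0.
(* A grid fine enough for D <= e^2 (k + 1). *)
pose k := Num.truncn (D / (e * e)).
have [n Nn qQ] := Qq e _ (fun j : 'I_k.+2 => j%:R / k.+1%:R) N e0.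
exists n => //; apply: monotone_grid_close qQ => //.
by rewrite mulrA -ler_pdivrMl ?mulr_gt0// mulrC ltW// truncnS_gt.
Qed.

End monotone_cluster.

(** * Quantile functions *)

Section quantile.
Context {R : realType} d (T : measurableType d) (P : probability T R).
Variables (u : T -> R) (D : R).
Hypotheses (mu : measurable_fun setT u) (u_D : forall x, 0 <= u x <= D).

Let X : {RV P >-> R} :=
  HB.pack_for {RV P >-> R} u (isMeasurableFun.Build _ _ _ _ u mu).

Let F (x : R) : R := fine (cdf X x).

Let FE x : (F x)%:E = P (u @^-1` `]-oo, x]).
Proof. by rewrite /F fineK// fin_num_measure. Qed.

Let F_ge0 x : 0 <= F x. Proof. by rewrite fine_ge0. Qed.
Let F_le1 x : F x <= 1.
Proof.
rewrite -lee_fin FE; apply: probability_le1; rewrite -[X in measurable X]setTI.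
by apply: mu => //; exact: measurable_itv.
Qed.
Let F_nd : {homo F : x y / x <= y}.
Proof.
by move=> x y xy; rewrite /F fine_le ?fin_num_measure//; exact: cdf_nondecreasing.
Qed.

Let F_neg x : x < 0 -> F x = 0.
Proof.
move=> x0; apply: EFin_inj; rewrite FE (_ : _ @^-1` _ = set0) ?measure0//.
apply/seteqP; split => // t /=; rewrite in_itv/=.
by have /andP[ut _] := u_D t => /le_lt_trans/(_ x0)/(le_lt_trans ut); rewrite ltxx.
Qed.

Let F_D x : D <= x -> F x = 1.
Proof.
move=> Dx; apply: EFin_inj; rewrite FE (_ : _ @^-1` _ = setT) ?probability_setT//.
apply/seteqP; split => // t _ /=; rewrite in_itv/=.
by have /andP[_ tD] := u_D t; exact: le_trans Dx.
Qed.

Let F_rc (t x : R) : (forall e, 0 < e -> t <= F (x + e)) -> t <= F x.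
Proof.
move=> tF; rewrite -lee_fin /F fineK ?fin_num_measure//.
have cF := @cdf_right_continuous _ _ _ P X x.
rewrite -(cvg_lim _ cF)//; apply: lime_ge; first by apply/cvg_ex; eexists; exact: cF.
near=> y; have xy : x < y by near: y; exact: nbhs_right_gt.
have := tF (y - x) ltac:(by rewrite subr_gt0).
by rewrite addrC subrK -lee_fin /F fineK ?fin_num_measure.
Unshelve. all: by end_near. Qed.

(** The bound 0 <= x and the alternative D <= x keep the infimum in [0, D] also for t outside
    [0, 1], so that q is monotone and bounded on the whole line. *)
Let E (t : R) := [set x | 0 <= x /\ (t <= F x \/ D <= x)].
Let q t := inf (E t).

Let D_ge0 : 0 <= D.
Proof. by have /andP[] := u_D point; exact: le_trans. Qed.

Let E_inf t : has_inf (E t).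
Proof. by split; [exists D; split => //; right|exists 0 => x []]. Qed.

(** Right continuity of F puts the infimum into the set. The alternative D <= x is absorbed because
    F = 1 there and t <= 1. *)
Let q_galois (t x : R) : 0 <= t <= 1 -> 0 <= x -> (q t <= x) = (t <= F x).
Proof.
move=> /andP[t0 t1] x0; apply/idP/idP => [qx|tF]; last first.
  by apply: ge_inf; [case: (E_inf t)|split=> //; left].
apply: F_rc => e e0.
have [y [y0 yE] yq] := inf_adherent e0 (E_inf t).
have Fy : t <= F y by case: yE => // /F_D ->.
by apply: (le_trans Fy); apply: F_nd; rewrite (le_trans (ltW yq))// lerD2r.
Qed.

Lemma quantile : exists q : R -> R, [/\ {homo q : x y / x <= y},
  forall t, 0 <= q t <= D &
  forall B : set (measurableTypeR R), measurable B -> unif (q @^-1` B) = P (u @^-1` B)].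
Proof.
have q_nd : {homo q : x y / x <= y}.
  move=> s t st; apply: lb_le_inf; first by case: (E_inf t).
  move=> x [x0 xE]; apply: ge_inf; first by case: (E_inf s).
  by split => //; case: xE => [tx|]; [left; exact: le_trans tx|right].
have q_D t : 0 <= q t <= D.
  apply/andP; split; first by apply: lb_le_inf; [case: (E_inf t)|move=> x []].
  by apply: ge_inf; [case: (E_inf t)|split => //; right].
exists q; split => // B mB.
have mq : measurable_fun setT (q : measurableTypeR R -> measurableTypeR R).
  exact: nondecreasing_measurable.
pose Y := HB.pack_for {mfun (measurableTypeR R) >-> measurableTypeR R}
   (q : measurableTypeR R -> measurableTypeR R)
   (isMeasurableFun.Build _ _ _ _ (q : measurableTypeR R -> measurableTypeR R) mq).
pose U : probability (measurableTypeR R) R := unif.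
(* For 0 <= x, [q_galois] turns q t <= x into t <= F x, a subset of [0, 1) of length F x. The case F
   x = 1 is separate because the endpoint t = 1 is missing. *)
have key x : unif (q @^-1` `]-oo, x]) = P (u @^-1` `]-oo, x]).
  have [x0|x0] := ltP x 0.
    rewrite -FE F_neg// (_ : _ @^-1` _ = set0) ?measure0//.
    apply/seteqP; split => // t /=; rewrite in_itv/= => qx.
    by have /andP[/le_lt_trans/(_ (le_lt_trans qx x0))] := q_D t; rewrite ltxx.
  rewrite -FE unifE.
  have [p1|p1] := ltP (F x) 1.
    rewrite (_ : _ `&` _ = `[0, F x]%classic).
      rewrite lebesgue_measure_itv/= lte_fin; case: ltP => [|Fx0]; first by rewrite sube0.
      by congr EFin; apply/eqP; rewrite eq_le F_ge0.
    apply/seteqP; split => t /=; rewrite !in_itv/=.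
      by move=> [/andP[t0 t1] qx]; rewrite t0/= -q_galois// t0 ltW.
    move=> /andP[t0 tF]; have t1 := le_lt_trans tF p1.
    by rewrite t0 t1; split => //; rewrite q_galois// t0 ltW.
  rewrite (_ : _ `&` _ = `[0, 1[%classic).
    rewrite lebesgue_measure_itv/= lte01 sube0; congr EFin.
    by apply/eqP; rewrite eq_le F_le1 p1.
  apply/seteqP; split => t /=; rewrite !in_itv/=; first by case.
  move=> /andP[t0 t1]; rewrite t0 t1; split => //.
  by rewrite q_galois ?t0 ?(ltW t1)// (le_trans (ltW t1) p1).
pose X' := HB.pack_for {mfun T >-> measurableTypeR R} (u : T -> measurableTypeR R)
   (isMeasurableFun.Build _ _ _ _ (u : T -> measurableTypeR R) mu).
suff : distribution U Y B = distribution P X' B by [].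
apply: (@measure_unique _ R (measurableTypeR R) (@RGenOInfty.G R)
  (fun n => `]-n%:R, +oo[%classic) _ _ _ _ (distribution U Y) (distribution P X')) => //.
- exact: RGenOInfty.measurableE.
- move=> _ _ [x ->] [y ->]; exists (Num.max x y).
  by apply/seteqP; split => z /=; rewrite !in_itv/= !andbT gt_max => /andP.
- by move=> n; exists (- n%:R).
- apply/seteqP; split => // x _; exists (Num.truncn `|x|).+1 => //=.
  rewrite in_itv/= andbT ltrNl (le_lt_trans _ (truncnS_gt _))//.
  by rewrite -normrN ler_norm.
- move=> _ [x ->]; rewrite -setCitvl.
  have mx : measurable (`]-oo, x]%classic : set (measurableTypeR R)).
    exact: measurable_itv.
  have h1 := probability_setC (distribution U Y) mx.
  have h2 := probability_setC (distribution P X') mx.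
  apply: (etrans h1); apply: etrans (esym h2).
  exact: (congr1 (fun y => 1 - y)%E (key x)).
- by move=> k; rewrite (le_lt_trans (probability_le1 _ _)) ?ltry.
Qed.

End quantile.

(** * Lower and upper limits, and one-sided limits of monotone functions *)

Section ereal_limits.
Context {R : realType}.
Local Open Scope ereal_scope.
Implicit Types (u : nat -> \bar R) (a : \bar R).

Lemma limn_esup_gt u a N : a < limn_esup u -> exists2 n, (N <= n)%N & a < u n.
Proof.
move=> au; apply: contrapT => nu; move: au; apply/negP; rewrite -leNgt.
apply: ge_ereal_inf; exists (ereal_sup [set u n | n in [set n | (N <= n)%N]]).
  by exists [set n | (N <= n)%N] => //; exists N.
apply/ereal_supP => _ [n Nn <-]; rewrite leNgt; apply/negP => aun.
by apply: nu; exists n.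
Qed.

Lemma limn_einf_gt u a : a < limn_einf u ->
  exists N, forall n, (N <= n)%N -> a < u n.
Proof.
rewrite /limn_einf lteNr => /ereal_inf_lt[_ [V [N _ NV] <-] Va].
exists N => n /NV Vn; rewrite -lteN2; apply: le_lt_trans Va.
by apply: le_ereal_sup_tmp; exists (- u n) => //; exists n.
Qed.

Lemma limn_esup_lt u a : limn_esup u < a ->
  exists N, forall n, (N <= n)%N -> u n < a.
Proof.
move=> /ereal_inf_lt[_ [V [N _ NV] <-] Va]; exists N => n /NV Vn.
by apply: le_lt_trans Va; apply: ereal_sup_ubound; exists n.
Qed.

Lemma le_limn_esup u v : (forall n, u n <= v n) -> limn_esup u <= limn_esup v.
Proof.
move=> uv; apply/ereal_infP => _ [V oV <-]; apply: ge_ereal_inf.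
exists (ereal_sup [set u n | n in V]); first by exists V.
apply/ereal_supP => _ [n Vn <-]; apply: le_ereal_sup_tmp.
by exists (v n) => //; exists n.
Qed.

Lemma le_limn_einf u v : (forall n, u n <= v n) -> limn_einf u <= limn_einf v.
Proof. by move=> uv; rewrite leeN2; apply: le_limn_esup => n; rewrite leeN2. Qed.

Lemma limn_einf_ge u a N : (forall n, (N <= n)%N -> a <= u n) ->
  a <= limn_einf u.
Proof.
move=> au; rewrite /limn_einf leeNr; apply: ge_ereal_inf.
exists (ereal_sup [set - u n | n in [set n | (N <= n)%N]]).
  by exists [set n | (N <= n)%N] => //; exists N.
by apply/ereal_supP => _ [n Nn <-]; rewrite leeN2; exact: au.
Qed.

Lemma nonincreasing_lim_right (f : R -> \bar R) :
  {in `]0%R, +oo[ &, nonincreasing_fun f} ->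
  f e @[e --> 0^'+] --> ereal_sup [set f e | e in [set e | (0 < e)%R]].
Proof.
move=> nif; have := nonincreasing_at_right_cvge (BInfty _ false) _ nif.
rewrite (_ : [set` _] = [set e | (0 < e)%R]); first by apply.
by apply/seteqP; split => x /=; rewrite in_itv/= andbT.
Qed.

Lemma nondecreasing_lim_right (f : R -> \bar R) :
  {in `]0%R, +oo[ &, nondecreasing_fun f} ->
  f e @[e --> 0^'+] --> ereal_inf [set f e | e in [set e | (0 < e)%R]].
Proof.
move=> ndf; have := nondecreasing_at_right_cvge (BInfty _ false) _ ndf.
rewrite (_ : [set` _] = [set e | (0 < e)%R]); first by apply.
by apply/seteqP; split => x /=; rewrite in_itv/= andbT.
Qed.

Lemma nonincreasing_cvg_right (f : R -> \bar R) (l : \bar R) :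
  {in `]0%R, +oo[ &, nonincreasing_fun f} -> (forall e, (0 < e)%R -> f e <= l) ->
  (forall b, b < l -> exists2 e, (0 < e)%R & b < f e) ->
  f e @[e --> 0^'+] --> l.
Proof.
move=> nif fl lf; have := nonincreasing_lim_right nif.
rewrite (_ : ereal_sup _ = l)//; apply/eqP; rewrite eq_le; apply/andP; split.
  by apply/ereal_supP => _ [e e0 <-]; exact: fl.
rewrite leNgt; apply/negP => /lf[e e0]; apply/negP; rewrite -leNgt.
by apply: ereal_sup_ubound; exists e.
Qed.

Lemma nondecreasing_cvg_right (f : R -> \bar R) (l : \bar R) :
  {in `]0%R, +oo[ &, nondecreasing_fun f} -> (forall e, (0 < e)%R -> l <= f e) ->
  (forall b, l < b -> exists2 e, (0 < e)%R & f e < b) ->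
  f e @[e --> 0^'+] --> l.
Proof.
move=> ndf lf fl; have := nondecreasing_lim_right ndf.
rewrite (_ : ereal_inf _ = l)//; apply/eqP; rewrite eq_le; apply/andP; split.
  rewrite leNgt; apply/negP => /fl[e e0]; apply/negP; rewrite -leNgt.
  by apply: ereal_inf_lbound; exists e.
by apply/ereal_infP => _ [e e0 <-]; exact: lf.
Qed.

(** A strict inequality between extended values is replaced by a finite positive threshold, so that
    the estimates can be made in R even when a value is infinite. *)
Lemma lt_between_real (x y : \bar R) : 0 <= x -> x < y ->
  exists2 a : R, (0 < a)%R & x < a%:E /\ a%:E < y.
Proof.
case: x => [x| |] //; last by case: y.
rewrite lee_fin => x0; case: y => [y| |] //; rewrite ?lte_fin => xy.
  by exists ((x + y) / 2)%R; [lra|rewrite !lte_fin; lra].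
by exists (x + 1)%R; [lra|rewrite lte_fin ltry; lra].
Qed.

End ereal_limits.

(** * Bounding the box distance *)

Section box_facts.
Context {R : realType}.
Implicit Types X Y Z : mmSpace R.

Lemma box_sym X Y : box X Y = box Y X.
Proof.
suff half X' Y' : (box X' Y' <= box Y' X')%E by apply/eqP; rewrite eq_le !half.
apply/ereal_infP => _ [e [e0 [phi [psi [I0 [pphi ppsi mI I01 [Ie d]]]]]] <-].
apply: ereal_inf_lbound; exists e => //; split => //.
exists psi, phi, I0; split => //; split => // s t Is It.
by rewrite distrC; exact: d.
Qed.

Lemma box_lt X Y (e : R) : (box X Y < e%:E)%E ->
  exists e' : R, e' < e /\
  exists (phi : R -> X) (psi : R -> Y) (I0 : set (measurableTypeR R)),
    [/\ parameter phi, parameter psi, measurable I0, I0 `<=` `[0, 1[%classic &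
        ((1 - e')%:E <= lebesgue_measure I0)%E /\
        forall s t, I0 s -> I0 t ->
          `| mdist (phi s) (phi t) - mdist (psi s) (psi t) | <= e'].
Proof.
by move=> /ereal_inf_lt[_ [e' [e'0 h] <-]]; rewrite lte_fin => ee; exists e'.
Qed.

Lemma le_box X Y (phi : R -> X) (psi : R -> Y) (e : R) (G : set (measurableTypeR R)) :
  0 <= e -> parameter phi -> parameter psi -> measurable G -> ((1 - e)%:E <= unif G)%E ->
  (forall s t, G s -> G t -> `| mdist (phi s) (phi t) - mdist (psi s) (psi t) | <= e) ->
  (box X Y <= e%:E)%E.
Proof.
move=> e0 pphi ppsi mG Ge d; apply: ereal_inf_lbound; exists e => //; split => //.
exists phi, psi, (`[0, 1[%classic `&` G); split => //.
- by apply: measurableI => //; exact: measurable_itv.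
- by split=> [|s t [_ Gs] [_ Gt]]; [rewrite -unifE|exact: d].
Qed.

Lemma box_set_le X (P : mmSpace R -> Prop) Y : P Y -> (box_set X P <= box X Y)%E.
Proof. by move=> PY; apply: ereal_inf_lbound; exists Y. Qed.

(** X has full support, so a neighbourhood of f x pulls back to an open set of positive mass. Hence
    f takes all its values, not just almost all, in the support of nu, and factors through
    [iota]. *)
Lemma supported_dominated X Z (T : completeMetricType R) (nu : set (borel T) -> \bar R)
    (iota : Z -> T) (f : X -> T) : lip1 f ->
  (forall B : set (borel T), measurable B -> mm_mu X (f @^-1` B) = nu B) ->
  (forall x y, mdist (iota x) (iota y) = mdist x y) -> range iota = msupp nu ->
  (forall A : set (borel Z), measurable A -> exists B : set (borel T),
        [/\ measurable B, A = iota @^-1` B & mm_mu Z A = nu B]) ->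
  exists g : X -> Z, [/\ lip1 g, pushes g & iota \o g = f].
Proof.
move=> lf fnu iiso irange itrace.
have fS x : range iota (f x).
  rewrite irange => U oU Ufx; rewrite -fnu; last exact: borel_open.
  have : msupp (mm_mu X) x by rewrite mm_supp.
  by apply => //; have /continuousP := lip1_continuous lf; apply.
have [g gf] := choice (fun x => let: ex_intro2 z _ h := fS x in ex_intro _ z h).
have igf : iota \o g = f by apply/funext => x; exact: gf.
exists g; split => //; first by move=> x y; rewrite -iiso !gf; exact: lf.
by move=> A /itrace[B [mB -> ->]]; rewrite -comp_preimage igf fnu.
Qed.

(** The parameters agree with phi and psi only off null sets, which can be cut out of G without
    losing mass. Each of the two endpoints of a distance then moves by at most e / 2. *)
Lemma le_box_ae Y Z (T : metricType R) (iY : Y -> T) (iZ : Z -> T)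
   (pY : R -> Y) (pZ : R -> Z) (phi psi : R -> T) (e : R) (G : set (measurableTypeR R)) :
  0 <= e -> parameter pY -> parameter pZ ->
  (forall x y, mdist (iY x) (iY y) = mdist x y) ->
  (forall x y, mdist (iZ x) (iZ y) = mdist x y) ->
  almost_everywhere unif (fun t => iY (pY t) = phi t) ->
  almost_everywhere unif (fun t => iZ (pZ t) = psi t) ->
  measurable G -> ((1 - e)%:E <= unif G)%E ->
  (forall s, G s -> mdist (phi s) (psi s) <= e / 2) ->
  (box Y Z <= e%:E)%E.
Proof.
move=> e0 ppY ppZ iisoY iisoZ [A [mA A0 sA]] [B [mB B0 sB]] mG Ge d.
have inY t : ~ A t -> iY (pY t) = phi t by move=> nA; apply: contrapT => /sA.
have inZ t : ~ B t -> iZ (pZ t) = psi t by move=> nB; apply: contrapT => /sB.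
apply: (@le_box _ _ pY pZ e (G `\` (A `|` B))) => //.
- by apply: measurableD => //; exact: measurableU.
- rewrite (le_trans Ge)// (measureDI unif mG (measurableU _ _ mA mB)).
  rewrite -[leRHS]adde0 leeD2l//.
  rewrite (le_trans (measureIr unif mG (measurableU _ _ mA mB)))//.
  by rewrite -[leRHS]adde0 -{1}A0 -B0; exact: measureU2.
move=> s t [Gs /not_orP[nAs nBs]] [Gt /not_orP[nAt nBt]].
rewrite -iisoY -iisoZ !inY// !inZ//.
have ds := d _ Gs; have dt := d _ Gt.
have := metric_triangle (phi s) (psi s) (phi t).
have := metric_triangle (psi s) (psi t) (phi t).
have := metric_triangle (psi s) (phi s) (psi t).
have := metric_triangle (phi s) (phi t) (psi t).
rewrite (metric_sym (psi t) (phi t)) (metric_sym (psi s) (phi s)).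
rewrite ler_norml; lra.
Qed.

End box_facts.

Section precompactness.
Context {R : realType} (T : completeMetricType R).
Hypothesis sepT : separable T.
Variables (theta : R -> T) (K D : R).
Hypotheses (K0 : 0 < K)
  (theta_lip : forall s t, mdist (theta s) (theta t) <= K * `|s - t|).

Lemma lipschitz_borel (q : R -> R) : {homo q : x y / x <= y} ->
  measurable_fun setT (theta \o q : measurableTypeR R -> borel T).
Proof.
move=> q_nd; apply: (@measurability _ _ (measurableTypeR R) (borel T) setT
  (theta \o q) (@open T)) => //.
move=> _ [B oB <-]; rewrite comp_preimage.
have mq : measurable_fun setT q by exact: nondecreasing_measurable.
apply: mq => //; apply: open_measurable.
rewrite openE => t /= Bt; have /nbhs_mdist[e e0 eB] : nbhs (theta t) B.
  by apply: open_nbhs_nbhs.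
apply/nbhs_ballP; exists (e / K); first exact: divr_gt0.
move=> s; rewrite -ball_normE/= ltr_pdivlMr// mulrC => st.
by apply: eB; rewrite (le_lt_trans (theta_lip _ _)).
Qed.

(* X maps 1-Lipschitzly into T through the segment [0, D] and theta, and Phi holds
   for every space that realizes the law of this map in T. The lift u to the line
   is only measurable. *)
Definition factors_through (Phi : mmSpace R -> Prop) (X : mmSpace R) :=
  exists u : X -> R,
    [/\ measurable_fun setT (u : borel X -> measurableTypeR R),
        forall x, 0 <= u x <= D, lip1 (theta \o u) &
        forall (Y : mmSpace R) (g : X -> Y) (iota : Y -> T),
          lip1 g -> pushes g -> (forall y z, mdist (iota y) (iota z) = mdist y z) ->
          iota \o g = theta \o u -> Phi Y].

Let realizes (P : mmSpace R -> Prop) Phi (q : R -> R) :=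
  [/\ {homo q : x y / x <= y}, forall t, 0 <= q t <= D &
   exists Y : mmSpace R, [/\ P Y, Phi Y &
     exists (iota : Y -> T) (psi : R -> Y),
     [/\ forall x y, mdist (iota x) (iota y) = mdist x y, parameter psi &
     almost_everywhere unif (fun t => iota (psi t) = theta (q t))]]].

(** The image of X is rebuilt from the quantile function q of u: theta o q and theta o u have the
    same law, so X dominates the space on its support, and downward closure puts that space in P. *)
Let factors_realizes P Phi X : pyramid P -> P X -> factors_through Phi X ->
  exists q, realizes P Phi q.
Proof.
move=> pP PX [u [mu u_D lu uPhi]].
have [q [q_nd q_D qu]] := quantile (mm_mu X) mu u_D.
exists q; split => //.
have mq := lipschitz_borel q_nd.
have [Y [iota [psi [iiso irange ppsi iae itrace]]]] := support_space sepT mq.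
have [B mB|g [lg pg ig]] := supported_dominated lu _ iiso irange itrace.
  have mB' : measurable (theta @^-1` B : set (measurableTypeR R)).
    rewrite -[X in measurable X]setTI.
    by apply: (@lipschitz_borel id) => //; move=> x y.
  rewrite lawE -unifE; exact: (esym (qu _ mB')).
exists Y; split; [|exact: uPhi ig|by exists iota, psi].
by apply: (pyramid_down pP PX); exists g.
Qed.

Lemma precompactness (P_ : nat -> mmSpace R -> Prop) P (Phi : mmSpace R -> Prop) :
  (forall n, pyramid (P_ n)) -> weak_cvg P_ P ->
  (forall N, exists2 n, (N <= n)%N & exists2 X, P_ n X & factors_through Phi X) ->
  exists2 Z, P Z & forall e : R, 0 < e -> exists2 Y, Phi Y & (box Y Z < e%:E)%E.
Proof.
move=> pP_ [_ wcvg] freq.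
have h N : exists nq : nat * (R -> R), (N <= nq.1)%N /\ realizes (P_ nq.1) Phi nq.2.
  have [n Nn [X PX fX]] := freq N.
  by have [q rq] := factors_realizes (pP_ n) PX fX; exists (n, q).
have {h}[nq nqP] := choice h.
have [||Q [Q_nd Q_D Qq]] := @monotone_cluster R D (fun N => (nq N).2).
- by move=> n; have [_ []] := nqP n.
- by move=> n; have [_ []] := nqP n.
have [Z [iZ [pZ [iisoZ _ ppZ aeZ _]]]] := support_space sepT (lipschitz_borel Q_nd).
have close (e : R) N : 0 < e -> exists2 n, (N <= n)%N &
    exists Y, [/\ P_ n Y, Phi Y & (box Y Z <= e%:E)%E].
  (* With |q - Q| <= 2 d, the points move in T by at most 2 K d <= e / 2, the bound required by
     [le_box_ae]. *)
  move=> e0; pose d := Num.min e (e / (4 * K)).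
  have d0 : 0 < d by rewrite lt_min e0 divr_gt0// mulr_gt0.
  have [m Nm mQ] := Qq d N d0.
  have [Nn [q_nd q_D [Y [PY PhiY [iY [pY [iisoY ppY aeY]]]]]]] := nqP m.
  exists (nq m).1; first exact: leq_trans Nn.
  exists Y; split => //.
  apply: (le_box_ae (ltW e0) ppY ppZ iisoY iisoZ aeY aeZ _ _ _
    (G := [set t | `|(nq m).2 t - Q t| <= 2 * d])).
  - exact: monotone_diff_measurable.
  - by rewrite (le_trans _ mQ)// lee_fin lerB// ge_min lexx.
  - move=> s /= qQ; rewrite (le_trans (theta_lip _ _))//.
    rewrite (@le_trans _ _ (K * (2 * d)))//; first by rewrite ler_pM2l.
    have : d <= e / (4 * K) by rewrite ge_min lexx orbT.
    by rewrite ler_pdivlMr ?mulr_gt0//; lra.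
exists Z.
  (* If Z were not in P, its box distance to P_n would eventually exceed some a > 0, against [close]
     at a. *)
  apply: contrapT => /wcvg/lt_between_real => /(_ (lexx _)) [a a0 [_ /limn_einf_gt[N aN]]].
  have [n Nn [Y [PY _ YZ]]] := close a N a0.
  have := aN _ Nn; apply/negP; rewrite -leNgt (le_trans (box_set_le _ PY))//.
  by rewrite box_sym.
move=> e e0; have [n _ [Y [_ PhiY YZ]]] := close (e / 2) 0%N ltac:(by rewrite divr_gt0).
by exists Y => //; rewrite (le_lt_trans YZ)// lte_fin; lra.
Qed.

End precompactness.

(** * Stability under the box distance *)

Section closure_metric.
Context {R : realType}.

Lemma mdistR (x y : R^o) : mdist x y = `|x - y|.
Proof. exact: distrC. Qed.

Lemma closure_mdist (T : metricType R) (S : set T) x (e : R) :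
  closure S x -> 0 < e -> exists2 s, S s & mdist x s < e.
Proof.
move=> cx e0; have [|s [Ss xs]] := cx [set y | mdist x y < e].
  by apply/nbhs_mdist; exists e.
by exists s.
Qed.

(** Images of measurable sets under a parameter or a 1-Lipschitz map need not be Borel, so sets are
    transported as closures of images. This bound and the next show that closing neither enlarges a
    diameter nor lowers a separation. *)
Lemma closure_diam_le (T : metricType R) (S : set T) (r : R) :
  (forall x y, S x -> S y -> mdist x y <= r) ->
  forall x y, closure S x -> closure S y -> mdist x y <= r.
Proof.
move=> Sr x y cx cy; apply/ler_addgt0Pl => e e0.
have e2 : 0 < e / 2 by rewrite divr_gt0.
have [s Ss xs] := closure_mdist cx e2; have [t St yt] := closure_mdist cy e2.
have := Sr _ _ Ss St; have := metric_triangle x s y; have := metric_triangle s t y.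
rewrite (metric_sym t y); lra.
Qed.

Lemma le_closure_mdist (T : metricType R) (S S' : set T) (r : R) :
  (forall x y, S x -> S' y -> r <= mdist x y) ->
  forall x y, closure S x -> closure S' y -> r <= mdist x y.
Proof.
move=> Sr x y cx cy; apply/ler_addgt0Pl => e e0.
have e2 : 0 < e / 2 by rewrite divr_gt0.
have [s Ss xs] := closure_mdist cx e2; have [t St yt] := closure_mdist cy e2.
have := Sr _ _ Ss St; have := metric_triangle s x t; have := metric_triangle x y t.
rewrite (metric_sym s x); lra.
Qed.

Lemma diam_ge0 (T : metricType R) (A : set T) : (0 <= diam A)%E.
Proof. by rewrite /diam le_max lexx. Qed.

Lemma diam_leP (T : metricType R) (A : set T) (r : \bar R) : (0 <= r)%E ->
  (forall x y, A x -> A y -> ((mdist x y)%:E <= r)%E) -> (diam A <= r)%E.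
Proof.
move=> r0 Ar; rewrite /diam ge_max r0/=.
by apply/ereal_supP => _ [x Ax [y Ay <-]]; exact: Ar.
Qed.

Lemma mdist_le_diam (T : metricType R) (A : set T) x y : A x -> A y ->
  ((mdist x y)%:E <= diam A)%E.
Proof.
move=> Ax Ay; rewrite /diam le_max; apply/orP; right.
by apply: ereal_sup_ubound; exists x => //; exists y.
Qed.

Lemma partial_diam_ge0 (T : metricType R) (nu : set T -> \bar R) (a : R) :
  (0 <= partial_diam nu a)%E.
Proof. by apply/ereal_infP => _ [A _ <-]; exact: diam_ge0. Qed.

Lemma partial_diam_le_diam (T : metricType R) (nu : set T -> \bar R) (a : R) (A : set T) :
  <<s @open T >> A -> (a%:E <= nu A)%E -> (partial_diam nu a <= diam A)%E.
Proof. by move=> mA aA; apply: ereal_inf_lbound; exists A. Qed.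

Lemma partial_diam_homo (T : metricType R) (nu : set T -> \bar R) :
  {homo partial_diam nu : a b / a <= b >-> (a <= b)%E}.
Proof.
move=> a b ab; apply/ereal_infP => _ [A [mA bA] <-].
by apply: partial_diam_le_diam => //; apply: le_trans bA; rewrite lee_fin.
Qed.

Lemma obs_diam_homo (X : mmSpace R) : {homo obs_diam X : a b / a <= b >-> (b <= a)%E}.
Proof.
move=> a b ab; apply/ereal_supP => _ [f lf <-].
apply: le_ereal_sup_tmp; eexists; first by exists f.
by apply: partial_diam_homo; rewrite lerB.
Qed.

Lemma obs_diam_ge0 (X : mmSpace R) a : (0 <= obs_diam X a)%E.
Proof.
pose f : X -> R^o := fun=> 0; apply: le_ereal_sup_tmp.
exists (partial_diam (pushforward (mm_mu X) (f : borel X -> borel R^o)) (1 - a)).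
  by exists f => // x y; rewrite mdistR subrr normr0 mdist_ge0.
exact: partial_diam_ge0.
Qed.

Lemma lip1_preimage_measurable (X : mmSpace R) (T : completeMetricType R)
    (f : X -> T) (A : set (borel T)) :
  lip1 f -> measurable A -> measurable (f @^-1` A : set (borel X)).
Proof.
move=> lf mA; rewrite -[X in measurable X]setTI.
by apply: (continuous_borel (lip1_continuous lf)).
Qed.

Lemma parameter_preimage (X : mmSpace R) (phi : R -> X) (I0 : set (measurableTypeR R))
   (A : set (borel X)) :
  parameter phi -> measurable I0 -> I0 `<=` `[0, 1[%classic -> measurable A ->
  measurable (I0 `&` phi @^-1` A : set (measurableTypeR R)).
Proof.
move=> [mphi _] mI I01 mA; rewrite -(setIidl I01) -setIA; apply: measurableI => //.
by apply: mphi => //; exact: measurable_itv.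
Qed.

Lemma parameter_mu_le (X : mmSpace R) (phi : R -> X) (S : set (measurableTypeR R))
   (A : set (borel X)) :
  parameter phi -> measurable S -> S `<=` `[0, 1[%classic -> measurable A ->
  (forall s, S s -> A (phi s)) -> (lebesgue_measure S <= mm_mu X A)%E.
Proof.
move=> pphi mS S01 mA SA; have [mphi <-] := pphi => //.
apply: le_measure; rewrite ?inE//; last by move=> s Ss; split; [exact: S01|exact: SA].
by apply: mphi => //; exact: measurable_itv.
Qed.

Lemma probability_setI_ge d (T : measurableType d) (P : probability T R)
    (A B : set T) (a b : R) :
  measurable A -> measurable B -> (a%:E <= P A)%E -> (b%:E <= P B)%E ->
  ((a + b - 1)%:E <= P (A `&` B))%E.
Proof.
move=> mA mB aA bB.
have PA : (P A <= P (~` B) + P (A `&` B))%E.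
  rewrite (measureDI P mA mB) leeD2r//; apply: le_measure; rewrite ?inE.
  - exact: measurableD.
  - exact: measurableC.
  - by move=> x [].
move: PA aA bB; rewrite probability_setC//.
have mAB := measurableI _ _ mA mB.
rewrite -(fineK (fin_num_measure P _ mA)) -(fineK (fin_num_measure P _ mB)).
rewrite -(fineK (fin_num_measure P _ mAB)) -EFinB -EFinD !lee_fin; lra.
Qed.

Lemma parameter_setI_ge (X : mmSpace R) (phi : R -> X) (I0 : set (measurableTypeR R))
   (A : set (borel X)) (a e : R) :
  parameter phi -> measurable I0 -> I0 `<=` `[0, 1[%classic -> measurable A ->
  ((1 - e)%:E <= lebesgue_measure I0)%E -> (a%:E <= mm_mu X A)%E ->
  ((a - e)%:E <= lebesgue_measure (I0 `&` phi @^-1` A))%E.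
Proof.
move=> pphi mI I01 mA Ie; have [mphi <-//] := pphi.
set J := `[0, 1[%classic `&` _ => aJ.
have mJ : measurable (J : set (measurableTypeR R)) by apply: mphi => //; exact: measurable_itv.
have eI (S : set (measurableTypeR R)) : S `<=` `[0, 1[%classic -> lebesgue_measure S = unif S.
  by move=> S01; rewrite unifE setIC setIidl.
have J01 : J `<=` `[0, 1[%classic by move=> x [].
have -> : I0 `&` phi @^-1` A = I0 `&` J by rewrite /J setIA (setIidl I01).
rewrite eI; last by move=> x [/I01].
rewrite eI// in aJ; rewrite eI// in Ie.
have := probability_setI_ge mI mJ Ie aJ.
by rewrite (_ : 1 - e + a - 1 = a - e)//; lra.
Qed.

End closure_metric.

Section box_invariants.
Context {R : realType}.
Implicit Types X Y : mmSpace R.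

(* The infimum is McShane's 1-Lipschitz extension of f o phi o psi^-1, which is
   1-Lipschitz up to e on psi @` I0. *)
Lemma almost_lip1_extension X Y (phi : R -> X) (psi : R -> Y) (I0 : set R) (e : R)
    (f : X -> R^o) : I0 !=set0 ->
  (forall s t, I0 s -> I0 t -> `| mdist (phi s) (phi t) - mdist (psi s) (psi t) | <= e) ->
  lip1 f ->
  exists2 g : Y -> R^o, lip1 g & forall t, I0 t -> `|g (psi t) - f (phi t)| <= e.
Proof.
move=> [s0 Is0] d lf.
have fd s t : I0 s -> I0 t -> f (phi t) <= f (phi s) + mdist (psi s) (psi t) + e.
  move=> Is It; have := lf (phi t) (phi s); have := d t s It Is.
  rewrite mdistR !ler_norml (metric_sym (psi s)); lra.
pose E y := [set f (phi s) + mdist (psi s) y | s in I0].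
have Ebd y : has_inf (E y).
  split; first by exists (f (phi s0) + mdist (psi s0) y), s0.
  exists (f (phi s0) - e - mdist (psi s0) y) => _ [s Is <-].
  have := fd _ _ Is Is0; have := metric_triangle (psi s) y (psi s0).
  rewrite (metric_sym y); lra.
pose g y : R^o := inf (E y).
have gle y s : I0 s -> g y <= f (phi s) + mdist (psi s) y.
  by move=> Is; apply: ge_inf; [case: (Ebd y)|exists s].
have g1 y z : g y <= g z + mdist y z.
  rewrite -lerBlDr; apply: lb_le_inf; first by case: (Ebd z).
  move=> _ [s Is <-]; have := gle y s Is; have := metric_triangle (psi s) z y.
  rewrite (metric_sym z); lra.
exists g => [y z|t It].
  have := g1 y z; have := g1 z y; rewrite mdistR ler_norml (metric_sym z); lra.
have := gle (psi t) t It; rewrite mdistxx => gt.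
have : f (phi t) - e <= g (psi t).
  apply: lb_le_inf; first by case: (Ebd (psi t)).
  by move=> _ [s Is <-]; have := fd _ _ Is It; lra.
have e0 : 0 <= e by rewrite (le_trans _ (d _ _ It It)).
rewrite ler_norml; lra.
Qed.

(** A test function f on X is carried to g on Y. A set A that is good for g is pulled back to
    parameters in I0 and pushed to the line by f o phi: less than e of mass is lost, and each
    endpoint of a distance moves by at most e, hence 2 e. *)
Lemma box_obs_diam X Y (k e : R) : e <= 1 -> (box X Y < e%:E)%E ->
  (obs_diam X (k + e) <= obs_diam Y k + (2 * e)%:E)%E.
Proof.
move=> e1 /box_lt[e' [ee [phi [psi [I0 [pphi ppsi mI I01 [Ie d]]]]]]].
(* Here e <= 1 enters: e' < 1 gives I0 positive measure. *)
have I0n : I0 !=set0.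
  apply/set0P/eqP => I00; move: Ie; rewrite I00 measure0 lee_fin; lra.
apply/ereal_supP => _ [f lf <-].
have [g lg gf] := almost_lip1_extension I0n d lf.
set nug := pushforward (mm_mu Y) (g : borel Y -> borel R^o).
apply: (@le_trans _ _ (partial_diam nug (1 - k) + (2 * e)%:E)%E); last first.
  by rewrite leeD2r//; apply: ereal_sup_ubound; exists g.
rewrite -leeBlDr//; apply/ereal_infP => _ [A [mA kA] <-]; rewrite leeBlDr//.
pose S := I0 `&` psi @^-1` (g @^-1` A).
have mgA : measurable (g @^-1` A : set (borel Y)) by exact: lip1_preimage_measurable.
have mS : measurable (S : set (measurableTypeR R)) by exact: parameter_preimage.
pose C : set R^o := closure ((f \o phi) @` S).
have mC : measurable (C : set (borel R^o)) by apply: borel_closed; exact: closed_closure.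
apply: (@le_trans _ _ (diam C)).
  apply: partial_diam_le_diam => //.
  apply: (@le_trans _ _ (lebesgue_measure S)).
    apply: le_trans (parameter_setI_ge ppsi mI I01 mgA Ie kA).
    by rewrite lee_fin; lra.
  apply: (parameter_mu_le pphi) => //; first by move=> s [/I01].
    exact: lip1_preimage_measurable.
  by move=> s Ss; apply: subset_closure; exists s.
have e0 : 0 <= e.
  have [s Is] := I0n.
  by apply: ltW; apply: le_lt_trans ee; exact: le_trans (normr_ge0 _) (d s s Is Is).
apply: diam_leP; first by rewrite adde_ge0// ?diam_ge0// lee_fin mulr_ge0.
have [->|] := eqVneq (diam A) +oo%E; first by move=> x y _ _; rewrite addye// leey.
have AD := @mdist_le_diam R R^o A.
have := diam_ge0 A; case E : (diam A) AD => [r| |]// AD r0 _ x y Cx Cy.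
rewrite lee_fin; apply: closure_diam_le Cx Cy => _ _ [s [Is gs] <-] [t [It gt] <-].
have := AD _ _ gs gt; rewrite lee_fin !mdistR/=.
have := gf _ Is; have := gf _ It; rewrite !ler_norml; lra.
Qed.

(** The sets A i travel to Y through the parameters in I0. Masses and mutual distances each drop by
    at most e. *)
Lemma box_sep X Y N (k : 'I_N.+1 -> R) (e : R) : (box X Y < e%:E)%E ->
  (sep X k <= sep Y (fun i => k i - e)%R + e%:E)%E.
Proof.
move=> /box_lt[e' [ee [phi [psi [I0 [pphi ppsi mI I01 [Ie d]]]]]]].
(* A negative e would force the measure of I0 above 1. *)
have [e0|e0] := leP 0 e; last first.
  have I1 : (lebesgue_measure I0 <= 1%:E)%E.
    by rewrite -(setIidr I01) -unifE; exact: probability_le1.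
  by exfalso; have := le_trans Ie I1; rewrite lee_fin; lra.
have s0 : (0 <= sep Y (fun i => k i - e)%R)%E by rewrite /sep le_max lexx.
rewrite {1}/sep ge_max adde_ge0//=.
apply/ereal_supP => _ [A mA <-].
pose S i := I0 `&` phi @^-1` A i.
have mS i : measurable (S i : set (measurableTypeR R)).
  by apply: parameter_preimage => //; case: (mA i).
pose B i : set (borel Y) := closure (psi @` S i).
rewrite -leeBlDr//; set m := \big[_/_]_(_ | _) _.
have mB i j : i != j -> (m - e%:E <= set_dist (B i) (B j))%E.
  move=> ij; rewrite leeBlDr//; apply: (@le_trans _ _ (set_dist (A i) (A j))).
    exact: (@bigmin_le_cond _ _ _ _ (i, j) (fun ij => ij.1 != ij.2)
      (fun ij => set_dist (A ij.1) (A ij.2))).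
  have Sd a b : (psi @` S i) a -> (psi @` S j) b ->
      (set_dist (A i) (A j) <= (mdist a b + e)%:E)%E.
    move=> [s [Is As] <-] [t [It At] <-]; apply: (@le_trans _ _ (mdist (phi s) (phi t))%:E).
      by apply: ereal_inf_lbound; exists (phi s) => //; exists (phi t).
    by rewrite lee_fin; have := d _ _ Is It; rewrite ler_norml; lra.
  rewrite -leeBlDr//; apply/ereal_infP => _ [x Bx [y By <-]]; rewrite leeBlDr// -EFinD.
  (* Points near x and y only serve to show that the distance of A i and A j is not +oo. *)
  have [a Sa _] := closure_mdist Bx ltr01; have [b Sb _] := closure_mdist By ltr01.
  have := Sd _ _ Sa Sb; have : (0 <= set_dist (A i) (A j))%E.
    by apply/ereal_infP => _ [? _ [? _ <-]]; rewrite lee_fin mdist_ge0.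
  case: (set_dist (A i) (A j)) Sd => [r| |]// Sd _ _.
  rewrite lee_fin -lerBlDr; apply: le_closure_mdist Bx By => x' y' /Sd h /h.
  by rewrite lee_fin lerBlDr.
rewrite /sep le_max; apply/orP; right; apply: le_ereal_sup_tmp.
exists (\big[mine/+oo%E]_(ij : 'I_N.+1 * 'I_N.+1 | ij.1 != ij.2)
    set_dist (B ij.1) (B ij.2)); last first.
  by apply: le_bigmin => [|[i j] /= /mB//]; rewrite leey.
exists B => // i; split; first by apply: borel_closed; exact: closed_closure.
have [mAi kAi] := mA i.
apply: (@le_trans _ _ (lebesgue_measure (S i))).
  apply: le_trans (parameter_setI_ge pphi mI I01 mAi Ie kAi).
  by rewrite lee_fin; lra.
apply: (parameter_mu_le ppsi) => //; first by move=> s [/I01].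
  by apply: borel_closed; exact: closed_closure.
by move=> s Ss; apply: subset_closure; exists s.
Qed.

Lemma sep_homo X N (k k' : 'I_N.+1 -> R) : (forall i, k i <= k' i) ->
  (sep X k' <= sep X k)%E.
Proof.
move=> kk; rewrite /sep ge_max le_max lexx/=.
apply/ereal_supP => _ [A mA <-]; rewrite le_max; apply/orP; right.
apply: ereal_sup_ubound; exists A => // i; have [mAi kAi] := mA i.
by split=> //; apply: le_trans kAi; rewrite lee_fin.
Qed.

End box_invariants.

(** * Bounded one-dimensional images *)

Section truncation.
Context {R : realType}.
Variable nu : probability (borel R^o) R.

Let ray_measurable (x : R) : measurable ([set z | z < x] : set (borel R^o)).
Proof. by apply: borel_open; exact: open_lt. Qed.

Let seg_measurable (x y : R) : measurable ([set z | x <= z <= y] : set (borel R^o)).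
Proof.
rewrite (_ : mkset _ = [set z | x <= z] `&` [set z | z <= y]).
  by apply: borel_closed; apply: closedI; [exact: closed_ge|exact: closed_le].
by apply/seteqP; split => z /= => [/andP[]|[-> ->]].
Qed.

Lemma tight (e : R) : 0 < e ->
  exists M : R, ((1 - e)%:E <= nu [set z | - M <= z <= M]%R)%E.
Proof.
move=> e0; apply: contrapT => /forallNP nM.
pose F (n : nat) : set (borel R^o) := [set z : R | - n%:R <= z <= n%:R].
have FT : \bigcup_n F n = setT.
  apply/seteqP; split => // x _; exists (Num.truncn `|x|).+1 => //.
  by rewrite /F/= -ler_norml ltW// truncnS_gt.
have : nu \o F @ \oo --> nu (\bigcup_n F n).
  apply: nondecreasing_cvg_mu => [n||m n mn]; first exact: seg_measurable.
    by rewrite FT.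
  apply/subsetPset => x /= /andP[mx xm].
  have mn' : m%:R <= n%:R :> R by rewrite ler_nat.
  by apply/andP; split; lra.
rewrite FT probability_setT => cF.
have : (1 <= (1 - e)%:E :> \bar R)%E.
  rewrite -(cvg_lim _ cF)//; apply: lime_le; first by apply/cvg_ex; exists 1%E.
  apply: nearW => n /=; rewrite leNgt; apply/negP => /ltW; exact: nM.
by rewrite lee_fin; lra.
Qed.

Lemma diam_seg (x y : R) (r : R) : 0 <= r -> y - x <= r ->
  (diam ([set z | (x <= z <= y)%R] : set R^o) <= r%:E)%E.
Proof.
move=> r0 xy; apply: diam_leP => [|s t /= /andP[xs sy] /andP[xt ty]]; first by rewrite lee_fin.
by rewrite lee_fin mdistR ler_norml; apply/andP; split; lra.
Qed.

(** The strict inequality makes F y - F x the mass of [x, y), the piece that is cut off below. *)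
Let F (x : R) : R := fine (nu [set z | z < x]).
Let FE x : (F x)%:E = nu [set z | z < x].
Proof. by rewrite /F fineK// fin_num_measure. Qed.
Let F_ge0 x : 0 <= F x. Proof. by rewrite -lee_fin FE. Qed.
Let F_le1 x : F x <= 1.
Proof. by rewrite -lee_fin FE; apply: probability_le1. Qed.
Let F_nd x y : x <= y -> F x <= F y.
Proof.
move=> xy; rewrite -lee_fin !FE; apply: le_measure; rewrite ?inE//.
by move=> z /= zx; exact: lt_le_trans xy.
Qed.

(* The largest 1-Lipschitz function below (a / eta) F, where F is the
   distribution function of nu: it is bounded because it contracts the long
   stretches of little mass, and yet a set of mass m and diameter < a in the image
   comes, up to mass 2 eta, from a segment of length <= a. *)
Lemma bounded_contraction (k a eta : R) : 0 < a -> 0 < eta ->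
  (a%:E < partial_diam nu (1 - k))%E ->
  exists h : R^o -> R^o, [/\ lip1 h, forall x, 0 <= h x <= a / eta &
    (a%:E <= partial_diam (fun A => nu (h @^-1` A)) (1 - k + 2 * eta))%E].
Proof.
move=> a0 eta0 ak; pose L := a / eta.
have L0 : 0 < L by rewrite divr_gt0.
pose E x := [set `|x - y| + L * F y | y in [set: R]].
have LF y : 0 <= L * F y by rewrite mulr_ge0// ltW.
have Einf x : has_inf (E x).
  split; first by exists (`|x - x| + L * F x), x.
  by exists 0 => _ [y _ <-]; rewrite addr_ge0.
pose h (x : R^o) : R^o := inf (E x).
have hle x y : h x <= `|x - y| + L * F y.
  by apply: ge_inf; [case: (Einf x)|exists y].
have h1 x y : h x <= h y + `|x - y|.
  rewrite -lerBlDr; apply: lb_le_inf; first by case: (Einf y).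
  move=> _ [z _ <-]; have := hle x z; have := ler_distD y x z; lra.
have lh : lip1 h.
  move=> x y; have := h1 x y; have := h1 y x; rewrite !mdistR (distrC y) ler_norml; lra.
exists h; split => // [x|].
  apply/andP; split.
    apply: lb_le_inf; first by case: (Einf x).
    by move=> _ [y _ <-]; rewrite addr_ge0.
  rewrite (le_trans (hle x x))// subrr normr0 add0r -/L.
  by rewrite ger_pMr.
rewrite leNgt; apply/negP => /ereal_inf_lt[_ [A [mA kA] <-] Aa].
(* One eta of mass pays for the restriction to [-M, M], which gives the preimage of A an infimum x
   and a supremum x'. The other pays for the stretch [x, y) discarded below. *)
have [M M1] := tight eta0.
have mC : measurable (h @^-1` A : set (borel R^o)).
  rewrite -[X in measurable X]setTI.
  by apply: (continuous_borel (lip1_continuous lh)).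
pose C0 := (h @^-1` A) `&` [set z | - M <= z <= M].
have C0m : ((1 - k + eta)%:E <= nu C0)%E.
  have := probability_setI_ge mC (seg_measurable (- M) M) kA M1.
  by rewrite (_ : 1 - k + 2 * eta + (1 - eta) - 1 = 1 - k + eta)//; lra.
suff [B mB [kB Ba]] : exists2 B : set R^o, measurable (B : set (borel R^o)) &
    ((1 - k)%:E <= nu B)%E /\ (diam B <= a%:E)%E.
  move: ak; apply/negP; rewrite -leNgt; apply: le_trans Ba.
  exact: partial_diam_le_diam.
have [C00|/set0P[c C0c]] := eqVneq C0 set0.
  exists set0 => //; split.
    by rewrite measure0; move: C0m; rewrite C00 measure0 !lee_fin; lra.
  by apply: diam_leP => //; rewrite lee_fin ltW.
have supC : has_sup C0 by split; [exists c|exists M => z [_ /andP[]]].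
have infC : has_inf C0 by split; [exists c|exists (- M) => z [_ /andP[]]].
set x := inf C0; set x' := sup C0.
have C0x z : C0 z -> x <= z <= x'.
  by move=> Cz; rewrite ge_inf ?sup_upper_bound//; case: infC.
(* x and x' are only limits of points of C0, so the gap d between [diam A] and a absorbs two errors
   of d / 3. *)
have hxx : h x' - h x < a.
  have [d d0 Ad] : exists2 d, 0 < d & forall u v, A u -> A v -> `|u - v| <= a - d.
    have := diam_ge0 A; have := @mdist_le_diam R R^o A.
    case: (diam A) Aa => [r| |]//; rewrite lte_fin => ra Ar _.
    exists (a - r); first by rewrite subr_gt0.
    by move=> u v Au Av; have := Ar _ _ Au Av; rewrite lee_fin mdistR; lra.
  have d3 : 0 < d / 3 by rewrite divr_gt0.
  have [u Cu ux] := inf_adherent d3 infC.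
  have [v Cv vx] := sup_adherent d3 supC.
  have := Ad _ _ (proj1 Cv) (proj1 Cu); rewrite ler_norml => hd.
  have /andP[xu _] := C0x _ Cu; have /andP[_ vx'] := C0x _ Cv.
  have := h1 x' v; have := h1 u x; rewrite -/x in ux; rewrite -/x' in vx.
  by rewrite (ger0_norm (_ : 0 <= u - x)) ?(ger0_norm (_ : 0 <= x' - v)) ?subr_ge0//; lra.
have e0 : 0 < a - (h x' - h x) by rewrite subr_gt0.
(* A near-minimizer y for h x' decides which segment to keep. If y < x, comparing with h x <= |x -
   y| + L F y gives x' - x < a, and [x, x'] works. Otherwise h x <= L F x <= L F y gives |x' - y| <
   a and L (F y - F x) < a = L eta, so [y, x'] is short and [x, y) has mass at most eta. *)
have [_ [y _ <-] yh] := inf_adherent e0 (Einf x').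
have {}yh : `|x' - y| + L * F y < h x + a by move: yh; rewrite -/(h x'); lra.
have [yx|xy] := ltP y x.
  exists [set z | x <= z <= x']; first exact: seg_measurable.
  split; last first.
    apply: diam_seg; first exact: ltW.
    have := hle x y; move: yh.
    have /andP[xc cx] := C0x _ C0c.
    by rewrite (ger0_norm (_ : 0 <= x - y)) ?ger0_norm; lra.
  apply: (@le_trans _ _ (nu C0)); first by apply: le_trans C0m; rewrite lee_fin; lra.
  by apply: le_measure; rewrite ?inE//; exact: measurableI.
exists [set z | y <= z <= x']; first exact: seg_measurable.
have hxF := hle x x; rewrite subrr normr0 add0r in hxF.
have Fxy := F_nd xy; have x'y := ler_norm (x' - y); have x'y0 := normr_ge0 (x' - y).
have LFxy : L * F x <= L * F y by rewrite ler_pM2l.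
split; last by apply: diam_seg; [exact: ltW|lra].
have Feta : F y - F x <= eta.
  have : L * (F y - F x) <= L * eta by rewrite mulrBr {3}/L divfK ?gt_eqF//; lra.
  by rewrite ler_pM2l.
have mxy : measurable ([set z | z < y] `\` [set z | z < x] : set (borel R^o)) by exact: measurableD.
have nuxy : nu ([set z | z < y] `\` [set z | z < x]) = (F y - F x)%:E.
  rewrite measureD// ?EFinB ?FE; last by rewrite (le_lt_trans (probability_le1 _ _)) ?ltry.
  rewrite setIidr//; by move=> z /= zx; exact: lt_le_trans xy.
have C0s : C0 `<=` ([set z | z < y] `\` [set z | z < x]) `|` [set z | y <= z <= x'].
  move=> z /C0x/andP[xz zx']; have [zy|yz] := ltP z y.
    by left; split => //=; apply/negP; rewrite -leNgt.
  by right; rewrite /= yz.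
have : (nu C0 <= (F y - F x)%:E + nu [set z | (y <= z <= x')%R])%E.
  rewrite -nuxy; apply: le_trans (measureU2 _ mxy (seg_measurable _ _)).
  by apply: le_measure; rewrite ?inE//; [exact: measurableI|exact: measurableU].
move=> /(le_trans C0m); rewrite -(fineK (fin_num_measure nu _ (seg_measurable y x'))).
by rewrite -EFinD !lee_fin; lra.
Qed.

End truncation.

(** * The sup metric on matrices, and separability *)

Section matrix_metric.
Context {R : realType} (m n : nat).
Implicit Types x y : 'M[R]_(m, n).

Let d x y : R := `|x - y|.
Let d_ge0 x y : 0 <= d x y. Proof. exact: normr_ge0. Qed.
Let d_pos x y : d x y = 0 -> x = y.
Proof. by move=> /normr0_eq0/eqP; rewrite subr_eq0 => /eqP. Qed.
Let d_ball x e : ball x e = [set y | d x y < e].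
Proof. by rewrite -ball_normE. Qed.

HB.instance Definition _ :=
  @PseudoMetric_isMetric.Build R 'M[R]_(m, n) d d_ge0 d_pos d_ball.

Let dE x y : mdist x y = \big[Num.max/0]_ij `|(x - y) ij.1 ij.2|.
Proof. exact: mx_normrE. Qed.

Lemma mx_mdist_leP x y (e : R) : 0 <= e ->
  (forall i j, `|x i j - y i j| <= e) -> mdist x y <= e.
Proof.
move=> e0 xy; rewrite dE.
by apply: bigmax_le => // -[i j] _; rewrite !mxE.
Qed.

Lemma mx_mdist_ge x y i j : `|x i j - y i j| <= mdist x y.
Proof.
rewrite dE.
apply: le_trans (le_bigmax _ (fun ij => `|(x - y) ij.1 ij.2|) (i, j)).
by rewrite /= !mxE.
Qed.

End matrix_metric.

Section separable_examples.
Context {R : realType}.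

Lemma matrix_separable m n : separable ('M[R]_(m, n) : completeMetricType R).
Proof.
pose g k : 'M[R]_(m, n) := map_mx ratr (odflt 0 (@unpickle 'M[rat]_(m, n) k)).
apply: (@seq_separable _ _ g) => x e e0.
have /choice[q qx] : forall ij : 'I_m * 'I_n, exists q : rat, `|ratr q - x ij.1 ij.2| <= e / 2.
  move=> [i j] /=.
  have [|q] := @rat_in_itvoo R (x i j) (x i j + e / 2); first by rewrite ltrDl divr_gt0.
  rewrite in_itv/= => /andP[h1 h2]; exists q; rewrite ler_norml; lra.
exists (pickle (\matrix_(i, j) q (i, j) : 'M[rat]_(m, n))); rewrite /g pickleK /=.
apply: (@le_lt_trans _ _ (e / 2)); last lra.
apply: mx_mdist_leP => [|i j]; first lra.
by rewrite !mxE; exact: (qx (i, j)).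
Qed.

Lemma real_separable : separable (R^o : completeMetricType R).
Proof.
pose g k : R^o := ratr (odflt 0 (@unpickle rat k)).
apply: (@seq_separable _ _ g) => x e e0.
have [|q] := @rat_in_itvoo R x (x + e); first by rewrite ltrDl.
rewrite in_itv/= => /andP[h1 h2]; exists (pickle q).
rewrite /g pickleK mdistR/= ltr_norml; lra.
Qed.

Lemma lip1_measurable (X : mmSpace R) (f : X -> R^o) : lip1 f ->
  measurable_fun setT (f : borel X -> measurableTypeR R).
Proof.
move=> lf; apply: (@measurability _ _ (borel X) (measurableTypeR R) setT f
  (@RGenOInfty.G R)); first exact: RGenOInfty.measurableE.
move=> _ [_ [x ->] <-]; rewrite setTI; apply: sub_sigma_algebra.
have /continuousP := lip1_continuous lf; apply.
by rewrite (_ : `]x, +oo[%classic = [set y | x < y]) ?set_itvE//; exact: open_gt.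
Qed.

End separable_examples.

Section star.
Context {R : realType} (N : nat) (s : R).
Hypothesis s0 : 0 < s.
Implicit Types i j : 'I_N.+1.

Let h := s / 2.
(** Leg i is visited during [s i, s i + s]: outwards from the centre to its tip at time c i, then
    back. *)
Let c i : R := s * i%:R + h.
Let tent i (t : R) := Num.max 0 (h - `|t - c i|).

(* A star with N.+1 legs of length s / 2, embedded isometrically in sup norm;
   the line visits the legs one after the other. *)
Definition star (t : R) : 'M[R]_N.+1 := \matrix_(i, j) (tent i t - tent j t).

Definition star_length := \sum_i c i.

Lemma star_lip t u : mdist (star t) (star u) <= 2 * `|t - u|.
Proof.
apply: mx_mdist_leP => [|i j]; first by rewrite mulr_ge0.
have L k : `|tent k t - tent k u| <= `|t - u|.
  rewrite /tent; have := ler_distD t u (c k); have := ler_distD u t (c k).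
  rewrite (distrC u t); have := normr_ge0 (t - u).
  by case: (leP 0 (h - `|t - c k|)); case: (leP 0 (h - `|u - c k|)) => ? ? ? ? ?;
    rewrite ler_norml; lra.
by have := L i; have := L j; rewrite !mxE !ler_norml; lra.
Qed.

Let h0 : 0 < h. Proof. by rewrite divr_gt0. Qed.
Let hs : s = h + h. Proof. by rewrite /h; lra. Qed.

Let c_dist i j : i != j -> s <= `|c i - c j|.
Proof.
move=> ij; rewrite /c opprD addrACA subrr addr0 -mulrBr normrM gtr0_norm//.
rewrite ler_peMr ?(ltW s0)//.
have [lt|lt|/val_inj/eqP] := ltngtP i j; last by rewrite (negbTE ij).
  by rewrite distrC -natrB ?(ltnW lt)// normr_nat ler1n subn_gt0.
by rewrite -natrB ?(ltnW lt)// normr_nat ler1n subn_gt0.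
Qed.

Let c_ge i : h <= c i. Proof. by rewrite lerDr mulr_ge0// ltW. Qed.

Section lift.
Context (X : mmSpace R) (A : 'I_N.+1 -> set X).
Hypotheses (A0 : forall i, A i !=set0)
  (A_dist : forall i j, i != j -> (s%:E <= set_dist (A i) (A j))%E).

Let E i x := [set mdist x a | a in A i].
Let dA i (x : X) : R^o := inf (E i x).

Let E_inf i x : has_inf (E i x).
Proof.
split; first by have [a Aa] := A0 i; exists (mdist x a), a.
by exists 0 => _ [a _ <-]; exact: mdist_ge0.
Qed.

Let dA_ge0 i x : 0 <= dA i x.
Proof.
by apply: lb_le_inf; [case: (E_inf i x)|move=> _ [a _ <-]; exact: mdist_ge0].
Qed.

Let dA_le i x a : A i a -> dA i x <= mdist x a.
Proof. by move=> Aa; apply: ge_inf; [case: (E_inf i x)|exists a]. Qed.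

Let dA_eq0 i a : A i a -> dA i a = 0.
Proof.
by move=> Aa; apply/eqP; rewrite eq_le dA_ge0 andbT -(mdistxx a) dA_le.
Qed.

Let dA_tri i x y : dA i x <= dA i y + mdist x y.
Proof.
rewrite -lerBlDr; apply: lb_le_inf; first by case: (E_inf i y).
move=> _ [a Aa <-]; have := dA_le x Aa; have := metric_triangle x y a; lra.
Qed.

Let dA_lip i : lip1 (dA i).
Proof.
move=> x y; have := dA_tri i x y; have := dA_tri i y x.
rewrite mdistR ler_norml (metric_sym y x); lra.
Qed.

Let dA_sum i j x : i != j -> s <= dA i x + dA j x.
Proof.
move=> ij; rewrite -lerBlDr; apply: lb_le_inf; first by case: (E_inf i x).
move=> _ [a Aa <-]; rewrite lerBlDr addrC -lerBlDr.
apply: lb_le_inf; first by case: (E_inf j x).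
move=> _ [b Ab <-]; rewrite lerBlDr.
have : (s%:E <= (mdist a b)%:E)%E.
  apply: (le_trans (A_dist ij)); apply: ereal_inf_lbound.
  by exists a => //; exists b.
rewrite lee_fin; have := metric_triangle a x b; rewrite (metric_sym a x); lra.
Qed.

(** A point closer than h to A i goes to the outward half of leg i, at depth h - dA i x; by [dA_sum]
    at most one i qualifies, so the sum u has at most one nonzero term. All other points go to time
    0, the centre of the star. At dA i x = h the time may jump, but the star is at its centre on
    both sides. *)
Let leg i x := if dA i x < h then c i - dA i x else 0.
Let u x := \sum_i leg i x.

Let leg_bounds i x : 0 <= leg i x <= c i.
Proof.
have ci := c_ge i; have di := dA_ge0 i x; rewrite /leg.
case: (ltP (dA i x) h) => dh.
  by rewrite subr_ge0 (le_trans (ltW dh) ci) gerBl.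
by rewrite lexx (le_trans _ ci)// ltW.
Qed.

Let u_bounds x : 0 <= u x <= star_length.
Proof.
apply/andP; split; first by apply: sumr_ge0 => i _; have /andP[] := leg_bounds i x.
by apply: ler_sum => i _; have /andP[] := leg_bounds i x.
Qed.

Let leg_measurable i : measurable_fun setT (leg i : borel X -> measurableTypeR R).
Proof.
apply: measurable_fun_ifT => //.
- by apply: measurable_fun_ltr => //; exact: lip1_measurable.
- by apply: measurable_funB => //; exact: lip1_measurable.
Qed.

Let u_measurable : measurable_fun setT (u : borel X -> measurableTypeR R).
Proof. by apply: measurable_sum => i; exact: leg_measurable. Qed.

(** This eliminates the discontinuous u: star o u is now expressed by the 1-Lipschitz functions
    dA. *)
Let tent_u i x : tent i (u x) = Num.max 0 (h - dA i x).
Proof.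
have ss := hs; have hh := h0; have [[j jx]|nx] := pselect (exists j, dA j x < h).
  have uE : u x = c j - dA j x.
    rewrite /u (bigD1 j)//= big1 ?addr0 /leg ?jx// => k kj.
    have := dA_sum x kj; case: (ltP (dA k x) h) => // ? ?; lra.
  rewrite uE /tent; have [->|ij] := eqVneq i j.
    by rewrite addrAC subrr add0r normrN ger0_norm// dA_ge0.
  have := c_dist ij; have := dA_sum x ij.
  have := ler_distD (c j - dA j x) (c i) (c j).
  rewrite (distrC (c i) (c j - dA j x)).
  have -> : `|c j - dA j x - c j| = dA j x.
    by rewrite addrAC subrr add0r normrN ger0_norm// dA_ge0.
  move=> h1 h2 h3.
  by rewrite !max_l//; lra.
have nj j : h <= dA j x by rewrite leNgt; apply/negP => jx; apply: nx; exists j.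
rewrite /u big1 /leg; last by move=> j _; rewrite ltNge nj.
rewrite /tent sub0r normrN ger0_norm; last by rewrite (le_trans _ (c_ge i))// ltW.
have ci := c_ge i; have ni := nj i.
by rewrite !max_l//; lra.
Qed.

(** A difference of two 1-Lipschitz functions is in general only 2-Lipschitz. Here [dA_sum] leaves
    at most one of the two terms positive at each point, and for x on leg i and y on leg j, s - dA i
    x - dA j y <= dA j x - dA j y. *)
Let star_u_lip : lip1 (star \o u).
Proof.
move=> x y; apply: mx_mdist_leP => [|i j]; first exact: mdist_ge0.
rewrite /= !mxE !tent_u.
have [->|ij] := eqVneq i j; first by rewrite !subrr normr0 mdist_ge0.
have := hs; have := dA_sum x ij; have := dA_sum y ij.
have := dA_tri i x y; have := dA_tri i y x; have := dA_tri j x y; have := dA_tri j y x.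
rewrite (metric_sym y x) => *.
by case: (leP 0 (h - dA i x)); case: (leP 0 (h - dA i y));
  case: (leP 0 (h - dA j x)); case: (leP 0 (h - dA j y)) => *; rewrite ler_norml; lra.
Qed.

(** The antisymmetry of the matrix pays off: entry (i, j) is h at the tip of leg i and - h at the
    tip of leg j. *)
Let star_u_far i j a b : i != j -> A i a -> A j b ->
  s <= mdist (star (u a)) (star (u b)).
Proof.
move=> ij Aa Ab; apply: le_trans (mx_mdist_ge _ _ i j).
rewrite !mxE !tent_u (dA_eq0 Aa) (dA_eq0 Ab).
have ss := hs; have hh := h0.
have := dA_sum a ij; have := dA_sum b ij; rewrite (dA_eq0 Aa) (dA_eq0 Ab) => hb ha.
rewrite subr0 (max_r (ltW h0)) (max_l (_ : h - dA j a <= 0)); last lra.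
rewrite (max_l (_ : h - dA i b <= 0)); last lra.
by rewrite ger0_norm; lra.
Qed.

Lemma star_lift : exists u : X -> R,
  [/\ measurable_fun setT (u : borel X -> measurableTypeR R),
      forall x, 0 <= u x <= star_length, lip1 (star \o u) &
      forall i j a b, i != j -> A i a -> A j b ->
        s <= mdist (star (u a)) (star (u b))].
Proof. by exists u; split => // i j a b; exact: star_u_far. Qed.

End lift.
End star.

Section bounded_images.
Context {R : realType}.
Implicit Types X Y : mmSpace R.

(** On Y the embedding [iota] into the line is itself the test function: its law is that of h o f,
    whose partial diameter [bounded_contraction] bounds from below. *)
Lemma obs_diam_factors X (k a eta : R) : 0 < a -> 0 < eta ->
  (a%:E < obs_diam X k)%E ->
  @factors_through R R^o id (a / eta) (fun Y => a%:E <= obs_diam Y (k - 2 * eta))%E X.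
Proof.
move=> a0 eta0 /ereal_sup_gt[_ [f lf <-] af].
have mf : measurable_fun setT (f : borel X -> borel R^o).
  exact: continuous_borel (lip1_continuous lf).
pose nu : probability (borel R^o) R := distribution (mm_mu X)
  (HB.pack_for {mfun (borel X) >-> (borel R^o)} (f : borel X -> borel R^o)
     (isMeasurableFun.Build _ _ _ _ (f : borel X -> borel R^o) mf)).
have [h [lh h_D hdiam]] := @bounded_contraction _ nu k a eta a0 eta0 af.
have lu : lip1 (h \o f) by move=> x y; apply: le_trans (lh _ _) (lf _ _).
exists (h \o f); split => //.
- exact: lip1_measurable.
- by move=> x; exact: h_D.
move=> Y g iota lg pg iiso ig; apply: le_ereal_sup_tmp.
exists (partial_diam (pushforward (mm_mu Y) (iota : borel Y -> borel R^o))
  (1 - (k - 2 * eta))).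
  by exists iota => // x y; rewrite iiso.
apply: (le_trans hdiam); apply/ereal_infP => _ [A [mA kA] <-].
apply: partial_diam_le_diam => //.
have -> : nu (h @^-1` A) = mm_mu Y (iota @^-1` A).
  rewrite -pg; last by apply: lip1_preimage_measurable => // x y; rewrite iiso.
  by rewrite -[g @^-1` _]/((iota \o g) @^-1` A) ig.
by apply: le_trans kA; rewrite lee_fin; lra.
Qed.

(** Positive masses make the sets A i nonempty, as their distance functions require. In Y the
    closures of the images g (A i) are separated, because star o u keeps the sets s apart. *)
Lemma sep_factors X N (k : 'I_N.+1 -> R) (s : R) : 0 < s -> (forall i, 0 < k i) ->
  (s%:E < sep X k)%E ->
  @factors_through R 'M[R]_N.+1 (star N s) (star_length N s) (fun Y => s%:E <= sep Y k)%E X.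
Proof.
move=> s0 k0; rewrite /sep lt_max => /orP[|/ereal_sup_gt[_ [A mA <-] sA]].
  by rewrite lte_fin => /(lt_trans s0); rewrite ltxx.
have A0 i : A i !=set0.
  apply/set0P/eqP => Ai; have [_] := mA i; rewrite Ai measure0 lee_fin.
  by rewrite leNgt k0.
have A_dist i j : i != j -> (s%:E <= set_dist (A i) (A j))%E.
  move=> ij; apply: (le_trans (ltW sA)).
  exact: (@bigmin_le_cond _ _ _ _ (i, j) (fun ij => ij.1 != ij.2)
      (fun ij => set_dist (A ij.1) (A ij.2))).
have [u [mu u_D lu ufar]] := star_lift s0 A0 A_dist.
exists u; split => // Y g iota lg pg iiso ig.
rewrite le_max; apply/orP; right; apply: le_ereal_sup_tmp.
pose B i : set (borel Y) := closure (g @` A i).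
exists (\big[mine/+oo%E]_(ij : 'I_N.+1 * 'I_N.+1 | ij.1 != ij.2)
    set_dist (B ij.1) (B ij.2)).
  exists B => // i; have [mAi kAi] := mA i.
  have mBi : measurable (B i) by apply: borel_closed; exact: closed_closure.
  split => //; rewrite -pg//; apply: (le_trans kAi).
  apply: le_measure; rewrite ?inE//; first exact: lip1_preimage_measurable.
  by move=> x Ax; apply: subset_closure; exists x.
apply: le_bigmin => [|[i j] /= ij]; first by rewrite leey.
apply/ereal_infP => _ [x Bx [y By <-]]; rewrite lee_fin.
apply: le_closure_mdist Bx By => _ _ [a Aa <-] [b Ab <-].
rewrite -iiso -[iota (g a)]/((iota \o g) a) -[iota (g b)]/((iota \o g) b) ig.
exact: ufar ij Aa Ab.
Qed.

End bounded_images.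

(** * Weak limits of pyramids *)

Section pyramid_invariants.
Context {R : realType}.
Implicit Types (P : mmSpace R -> Prop).

Let sup_obs P (k e : R) := ereal_sup [set r | exists2 X, P X & obs_diam X (k + e) = r].

Lemma pyr_obs_diamE P k :
  pyr_obs_diam P k = ereal_sup [set sup_obs P k e | e in [set e | 0 < e]].
Proof.
apply: cvg_lim => //; apply: nonincreasing_lim_right => d e _ _ de.
apply/ereal_supP => _ [X PX <-]; apply: le_ereal_sup_tmp.
by exists (obs_diam X (k + d)); [exists X|apply: obs_diam_homo; rewrite lerD2l].
Qed.

Lemma pyr_obs_diam_gt P k (a : \bar R) : (a < pyr_obs_diam P k)%E ->
  exists e X, [/\ 0 < e, P X & (a < obs_diam X (k + e))%E].
Proof.
rewrite pyr_obs_diamE => /ereal_sup_gt[_ [e e0 <-]] /ereal_sup_gt[_ [X PX <-] aX].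
by exists e, X.
Qed.

Lemma obs_diam_le_pyr P X k k' : P X -> k < k' -> (obs_diam X k' <= pyr_obs_diam P k)%E.
Proof.
move=> PX kk; rewrite pyr_obs_diamE; apply: le_ereal_sup_tmp.
exists (sup_obs P k (k' - k)); first by exists (k' - k) => //=; rewrite subr_gt0.
by apply: ereal_sup_ubound; exists X => //; congr obs_diam; rewrite addrC subrK.
Qed.

Lemma pyr_obs_diam_homo P : {homo pyr_obs_diam P : a b / a <= b >-> (b <= a)%E}.
Proof.
move=> a b ab; rewrite leNgt; apply/negP => /pyr_obs_diam_gt[e [X [e0 PX]]].
apply/negP; rewrite -leNgt; apply: obs_diam_le_pyr => //.
by rewrite (le_lt_trans ab)// ltrDl.
Qed.

Lemma pyr_obs_diam_ge0 P k : pyramid P -> (0 <= pyr_obs_diam P k)%E.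
Proof.
move=> /pyramid_nonempty[X PX].
apply: le_trans (obs_diam_le_pyr PX (_ : k < k + 1)); last by rewrite ltrDl.
exact: obs_diam_ge0.
Qed.

Let sup_sep P N (k : 'I_N.+1 -> R) (e : R) :=
  ereal_sup [set r | exists2 X, P X & sep X (fun i => k i - e) = r].

Lemma pyr_sepE P N (k : 'I_N.+1 -> R) :
  pyr_sep P k = ereal_inf [set sup_sep P k e | e in [set e | 0 < e]].
Proof.
apply: cvg_lim => //; apply: nondecreasing_lim_right => d e _ _ de.
apply/ereal_supP => _ [X PX <-]; apply: le_ereal_sup_tmp.
exists (sep X (fun i => k i - e)); first by exists X.
by apply: sep_homo => i; rewrite lerB.
Qed.

Lemma sep_ge0 X N (k : 'I_N.+1 -> R) : (0 <= sep X k)%E.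
Proof. by rewrite /sep le_max lexx. Qed.

(** No strict margin is needed as for ObsDiam: lowering the masses only increases Sep, so the
    regularized value stays above that of each member. *)
Lemma sep_le_pyr P X N (k : 'I_N.+1 -> R) : P X -> (sep X k <= pyr_sep P k)%E.
Proof.
move=> PX; rewrite pyr_sepE; apply/ereal_infP => _ [e e0 <-].
apply: le_ereal_sup_tmp; exists (sep X (fun i => k i - e)); first by exists X.
by apply: sep_homo => i; rewrite gerBl ltW.
Qed.

Lemma pyr_sep_ge0 P N (k : 'I_N.+1 -> R) : pyramid P -> (0 <= pyr_sep P k)%E.
Proof.
move=> /pyramid_nonempty[X PX]; apply: le_trans (sep_le_pyr k PX); exact: sep_ge0.
Qed.

Lemma pyr_sep_lt P N (k : 'I_N.+1 -> R) (b : \bar R) : (pyr_sep P k < b)%E ->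
  exists2 e, 0 < e & (ereal_sup [set r | exists2 X, P X & sep X (fun i => k i - e)%R = r] < b)%E.
Proof. by rewrite pyr_sepE => /ereal_inf_lt[_ [e e0 <-] eb]; exists e. Qed.

Lemma pyr_sep_gt P N (k : 'I_N.+1 -> R) (a : \bar R) (e : R) : 0 < e ->
  (a < pyr_sep P k)%E -> exists2 X, P X & (a < sep X (fun i => k i - e)%R)%E.
Proof.
move=> e0; rewrite pyr_sepE => ak.
have : (a < sup_sep P k e)%E.
  by apply: (lt_le_trans ak); apply: ereal_inf_lbound; exists e.
by move=> /ereal_sup_gt[_ [X PX <-] aX]; exists X.
Qed.

Lemma pyr_sep_homo P N (k k' : 'I_N.+1 -> R) : (forall i, k i <= k' i) ->
  (pyr_sep P k' <= pyr_sep P k)%E.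
Proof.
move=> kk; rewrite !pyr_sepE; apply/ereal_infP => _ [e e0 <-].
apply: ge_ereal_inf; exists (sup_sep P k' e); first by exists e.
apply/ereal_supP => _ [X PX <-]; apply: le_ereal_sup_tmp.
exists (sep X (fun i => k i - e)); first by exists X.
by apply: sep_homo => i; rewrite lerD2r.
Qed.

End pyramid_invariants.

Section weak_limits.
Context {R : realType}.
Variables (P_ : nat -> mmSpace R -> Prop) (P : mmSpace R -> Prop).
Hypotheses (hP : pyramid P) (hP_ : forall n, pyramid (P_ n)) (hcvg : weak_cvg P_ P).

Lemma weak_cvg_approx X (e : R) : P X -> 0 < e ->
  exists N, forall n, (N <= n)%N -> exists2 Y, P_ n Y & (box X Y < e%:E)%E.
Proof.
move=> PX e0; have [_ lim0] := cvg_limn_einf_sup (hcvg.1 X PX).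
have [|N Ne] := @limn_esup_lt R (fun n => box_set X (P_ n)) e%:E.
  by rewrite lim0 lte_fin.
exists N => n /Ne /ereal_inf_lt[_ [Y PY <-] YX]; exists Y => //.
Qed.

Lemma obs_diam_limit_ge (k : R) (b : \bar R) : (b < pyr_obs_diam P k)%E ->
  exists2 e, 0 < e & (b < limn_einf (fun n => pyr_obs_diam (P_ n) (k + e)))%E.
Proof.
have [b0 _|b0] := ltP b 0%E.
  exists 1 => //; apply: (lt_le_trans b0); apply: (@limn_einf_ge _ _ _ 0%N) => n _.
  exact: pyr_obs_diam_ge0.
move=> /pyr_obs_diam_gt[d [X [d0 PX /(lt_between_real b0)[a a0 [ba aX]]]]].
case: b b0 ba => [b| |]//; rewrite lee_fin lte_fin => b0 ba.
(* The bound 1 is demanded by [box_obs_diam], d / 4 keeps k + d - eta above k + d / 2, and (a - b) /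
   4 keeps a - 2 eta above b. *)
pose eta := Num.min 1 (Num.min (d / 4) ((a - b) / 4)).
have eta0 : 0 < eta by rewrite !lt_min ltr01; apply/andP; split => //; apply/andP; split; lra.
have eta1 : eta <= 1 by rewrite ge_min lexx.
have etad : eta <= d / 4 by rewrite !ge_min lexx orbT.
have etaa : eta <= (a - b) / 4 by rewrite !ge_min lexx !orbT.
exists (d / 2); first by rewrite divr_gt0.
apply: (@lt_le_trans _ _ (a - 2 * eta)%:E); first by rewrite lte_fin; lra.
have [N NX] := weak_cvg_approx PX eta0.
apply: (@limn_einf_ge _ _ _ N) => n /NX[Y PY XY].
have := box_obs_diam (k + d - eta) eta1 XY; rewrite subrK => h.
rewrite EFinB leeBlDr//; apply: (le_trans (ltW aX)); apply: (le_trans h).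
by apply: leeD2r; apply: obs_diam_le_pyr => //; lra.
Qed.

Lemma obs_diam_limit_le (k e : R) : 0 < e ->
  (limn_esup (fun n => pyr_obs_diam (P_ n) (k + e)) <= pyr_obs_diam P k)%E.
Proof.
move=> e0; rewrite leNgt; apply/negP => /(lt_between_real (pyr_obs_diam_ge0 k hP)).
move=> [a a0 [Va aG]]; have e4 : 0 < e / 4 by rewrite divr_gt0.
have theta_lip (s t : R) : @mdist R R^o s t <= 1 * `|s - t| by rewrite mul1r mdistR.
(* The contraction with parameter e / 4 uses up 2 (e / 4) of the margin e. The remaining e / 2
   exceeds the box error eta <= e / 8 below, so the mass parameter for Z stays above k. *)
have [|Z PZ ZY] := @precompactness R R^o real_separable id 1 (a / (e / 4)) ltr01 theta_lip
    P_ P (fun Y => a%:E <= obs_diam Y (k + e - 2 * (e / 4)))%E hP_ hcvg.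
  move=> N; have [n Nn an] := limn_esup_gt N aG; exists n => //.
  have [d [X [d0 PX aX]]] := pyr_obs_diam_gt an.
  exists X => //; apply: obs_diam_factors => //; apply: (lt_le_trans aX).
  by apply: obs_diam_homo; rewrite lerDl ltW.
case E : (pyr_obs_diam P k) Va => [v| |]//; last by have := pyr_obs_diam_ge0 k hP; rewrite E.
rewrite lte_fin => va; pose eta := Num.min 1 (Num.min (e / 8) ((a - v) / 4)).
have eta0 : 0 < eta by rewrite !lt_min ltr01; apply/andP; split => //; apply/andP; split; lra.
have eta1 : eta <= 1 by rewrite ge_min lexx.
have etad : eta <= e / 8 by rewrite !ge_min lexx orbT.
have etaa : eta <= (a - v) / 4 by rewrite !ge_min lexx !orbT.
have [Y aY YZ] := ZY eta eta0.
have := box_obs_diam (k + e - 2 * (e / 4) - eta) eta1 YZ; rewrite subrK => h.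
have hZ : (obs_diam Z (k + e - 2 * (e / 4) - eta) <= v%:E)%E.
  by rewrite -E; apply: obs_diam_le_pyr => //; lra.
have := le_trans aY (le_trans h (leeD2r _ hZ)).
by rewrite -EFinD lee_fin; lra.
Qed.

Lemma sep_limit_ge N (k : 'I_N.+1 -> R) (e : R) : 0 < e ->
  (pyr_sep P k <= limn_einf (fun n => pyr_sep (P_ n) (fun i => k i - e)%R))%E.
Proof.
move=> e0; set l := limn_einf _.
have l0 : (0 <= l)%E.
  by apply: (@limn_einf_ge _ _ _ 0%N) => n _; exact: pyr_sep_ge0.
rewrite leNgt; apply/negP => /(lt_between_real l0)[a a0 [la aV]].
case E : l l0 la => [b| |]//; rewrite lee_fin lte_fin => b0 ba.
have e2 : 0 < e / 2 by rewrite divr_gt0.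
have [X PX aX] := pyr_sep_gt e2 aV.
(* One half of e was spent on passing from P to its member X; the other half covers the masses lost
   between X and Y. *)
pose eta := Num.min (e / 2) ((a - b) / 2).
have eta0 : 0 < eta by rewrite !lt_min; apply/andP; split; lra.
have etad : eta <= e / 2 by rewrite ge_min lexx.
have etaa : eta <= (a - b) / 2 by rewrite !ge_min lexx !orbT.
have [M MX] := weak_cvg_approx PX eta0.
have : ((a - eta)%:E <= l)%E.
  apply: (@limn_einf_ge _ _ _ M) => n /MX[Y PY XY].
  rewrite EFinB leeBlDr//; apply: (le_trans (ltW aX)); apply: (le_trans (box_sep _ XY)).
  apply: leeD2r; apply: (le_trans _ (sep_le_pyr _ PY)).
  by apply: sep_homo => i; lra.
by rewrite E lee_fin; lra.
Qed.

Lemma sep_limit_le N (k : 'I_N.+1 -> R) (b : \bar R) : (forall i, 0 < k i) ->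
  (pyr_sep P k < b)%E ->
  exists2 e, 0 < e & (limn_esup (fun n => pyr_sep (P_ n) (fun i => k i - e)%R) < b)%E.
Proof.
move=> k0 /pyr_sep_lt[d d0]; set S := ereal_sup _ => Sb.
have [m m0 mk] : exists2 m, 0 < m & forall i, m <= k i.
  exists (\big[Num.min/1]_i k i); last by move=> i; exact: bigmin_le.
  by apply/lt_bigmin => //.
(* The masses drop three times by at most e: in the statement, from P_n to a member, and from Y to
   Z. The total is at most d, and after two drops the masses are still at least m / 3 > 0, as
   [sep_factors] requires. *)
pose e := Num.min (d / 3) (m / 3).
have e0 : 0 < e by rewrite !lt_min; apply/andP; split; lra.
have ed : e <= d / 3 by rewrite ge_min lexx.
have em : e <= m / 3 by rewrite ge_min lexx orbT.
exists e => //; apply: le_lt_trans Sb; rewrite leNgt; apply/negP => Sl.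
have S0 : (0 <= S)%E.
  have [X PX] := pyramid_nonempty hP; apply: le_ereal_sup_tmp.
  by exists (sep X (fun i => k i - d)%R); [exists X|exact: sep_ge0].
have [a a0 [Sa al]] := lt_between_real S0 Sl.
have [|Z PZ ZY] := @precompactness R 'M[R]_N.+1 (matrix_separable _ _) (star N a) 2
    (star_length N a) (ltr0Sn R 1) (star_lip N a) P_ P
    (fun Y => a%:E <= sep Y (fun i => k i - e - e)%R)%E hP_ hcvg.
  move=> M; have [n Mn an] := limn_esup_gt M al; exists n => //.
  have [X PX aX] := pyr_sep_gt e0 an; exists X => //.
  by apply: sep_factors => // i; have := mk i; lra.
case E : S S0 Sa => [v| |]//; rewrite lee_fin lte_fin => v0 va.
pose eta := Num.min e ((a - v) / 2).
have eta0 : 0 < eta by rewrite !lt_min; apply/andP; split; lra.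
have etad : eta <= e by rewrite ge_min lexx.
have etaa : eta <= (a - v) / 2 by rewrite !ge_min lexx !orbT.
have [Y aY YZ] := ZY eta eta0.
have hZ : (sep Z (fun i => k i - e - e - eta)%R <= v%:E)%E.
  rewrite -E; apply: le_ereal_sup_tmp.
  by exists (sep Z (fun i => k i - d)%R); [exists Z|apply: sep_homo => i; lra].
have := le_trans aY (le_trans (box_sep _ YZ) (leeD2r _ hZ)).
by rewrite -EFinD lee_fin; lra.
Qed.

End weak_limits.

Theorem theorem1p1 (R : realType) (P : mmSpace R -> Prop)
    (P_ : nat -> mmSpace R -> Prop)
    (hP : pyramid P) (hP_ : forall n, pyramid (P_ n))
    (hcvg : weak_cvg P_ P) :
  (forall kappa : R, 0 < kappa ->
    (limn_einf (fun n => pyr_obs_diam (P_ n) (kappa + e)) @[e --> 0^'+]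
       --> pyr_obs_diam P kappa) /\
    (limn_esup (fun n => pyr_obs_diam (P_ n) (kappa + e)) @[e --> 0^'+]
       --> pyr_obs_diam P kappa)) /\
  (forall (N : nat) (kappa : 'I_N.+1 -> R), (1 <= N)%N ->
    (forall i, 0 < kappa i) ->
    (limn_einf (fun n => pyr_sep (P_ n) (fun i => kappa i - e)) @[e --> 0^'+]
       --> pyr_sep P kappa) /\
    (limn_esup (fun n => pyr_sep (P_ n) (fun i => kappa i - e)) @[e --> 0^'+]
       --> pyr_sep P kappa)).
Proof.
split=> [kappa _|N kappa _ kappa0].
  split; apply: nonincreasing_cvg_right.
  - move=> d e _ _ de; apply: le_limn_einf => n.
    by apply: pyr_obs_diam_homo; rewrite lerD2l.
  - move=> e e0; apply: le_trans (limn_einf_sup _) _.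
    exact: (obs_diam_limit_le hP).
  - move=> b; exact: obs_diam_limit_ge.
  - move=> d e _ _ de; apply: le_limn_esup => n.
    by apply: pyr_obs_diam_homo; rewrite lerD2l.
  - move=> e e0; exact: (obs_diam_limit_le hP).
  - move=> b /(obs_diam_limit_ge hP_ hcvg)[e e0 be].
    by exists e => //; apply: lt_le_trans be (limn_einf_sup _).
split; apply: nondecreasing_cvg_right.
- move=> d e _ _ de; apply: le_limn_einf => n.
  by apply: pyr_sep_homo => i; rewrite lerB.
- move=> e e0; exact: sep_limit_ge.
- move=> b /(sep_limit_le hP hP_ hcvg kappa0)[e e0 be].
  by exists e => //; apply: le_lt_trans (limn_einf_sup _) be.
- move=> d e _ _ de; apply: le_limn_esup => n.
  by apply: pyr_sep_homo => i; rewrite lerB.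
- move=> e e0; apply: le_trans (limn_einf_sup _).
  exact: sep_limit_ge.
- move=> b; exact: sep_limit_le.
Qed.
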